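(* Let $\mathcal S\subset\mathbb D$ and let $g:\mathcal S\to\mathbb C$ be a function for which there is a Blaschke function $f$ such that $\mathcal S\supset\{\mathcal O_f(z):z\in\mathcal S\}$ (that is, $\mathcal S$ contains the forward orbit $\mathcal O_f(z)=\{f^{\circ n}(z):n\ge 0\}$ of each of its points) and $g(f(z))=g(z)$ for all $z\in\mathcal S$. Then the following are equivalent: (1) There is a bounded holomorphic function $G$ on $\mathbb D$ such that $G|_{\mathcal S}=g$; (2) There exists $M>0$ such that the matrix-valued function $\Delta:(z,w)\mapsto\Delta(z,w)\in\mathcal B(\mathbb C^{n_z},\mathbb C^{n_w})$ on $\mathcal S\times\mathcal S$ defined by $$\Delta(z,w)=\left[\frac{M^2\alpha^2}{1-f^{\circ j}(z)\overline{f^{\circ l}(w)}}-\frac{g(z)\overline{g(w)}}{1-f^{\circ (j+1)}(z)\overline{f^{\circ (l+1)}(w)}}\right]_{j,l=(0,0)}^{(n_z-1,\,n_w-1)}$$ is a positive semi-definite kernel, where $\alpha^2=(1+|f(0)|)(1-|f(0)|)^{-1}$.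
   Context: $\mathbb D$ is the open unit disk. A Blaschke function is a finite Blaschke product $f(z)=e^{i\theta}\prod_{j=1}^N\frac{z-a_j}{1-\overline{a_j}z}$ with $\theta\in\mathbb R$ and $a_j\in\mathbb D$. $f^{\circ n}$ is the $n$-fold composition of $f$ with itself, $f^{\circ 0}$ being the identity. A point $z\in\mathbb D$ is a periodic point of $f$ if $f^{\circ n}(z)=z$ for some positive integer $n$; the least such $n$ is its period, denoted $n_z$; if there is no such positive integer, $n_z=\infty$. By convention $\mathbb C^\infty=\ell^2$, the Hilbert space of square summable sequences, and $\mathcal B(\mathbb C^{n_z},\mathbb C^{n_w})$ is the space of bounded operators from $\mathbb C^{n_z}$ to $\mathbb C^{n_w}$. In the matrix, $j$ runs over $0\le j\le n_z-1$ and $l$ over $0\le l\le n_w-1$ (over all non-negative integers when the period is infinite). Positive semi-definiteness of the kernel means $\sum_{i,k=1}^n\sum_{j,l}\Delta(z_i,z_k)_{j,l}\,c_{kl}\,\overline{c_{ij}}\ge 0$ for all finitely many points $z_1,\dots,z_n\in\mathcal S$ and all vectors $c_i=(c_{ij})_j\in\mathbb C^{n_{z_i}}$.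
   Formalization: For infinite periods Δ(z,w) need not be a bounded operator on ℓ² (f(z)=z², S={2^{-2^j}}, g=0), so boundedness is dropped from (2), and the form is required to be nonnegative only at those ℓ² vectors c_i for which its double series (summed along squares) converge. *)

(* Defs.v *)
From mathcomp Require Import all_boot all_order all_algebra.
From mathcomp Require Import complex.
From mathcomp Require Import all_classical all_reals all_analysis.
Set Implicit Arguments.
Unset Strict Implicit.
Unset Printing Implicit Defensive.
Import Order.TTheory GRing.Theory Num.Theory.
Import numFieldNormedType.Exports.
Local Open Scope classical_set_scope.
Local Open Scope complex_scope.
Local Open Scope ring_scope.

(* Declaring the type as a numClosedFieldType gives it the topology and the
   normed module structure of MathComp-Analysis, over itself.  In its order,
   0 <= x means that x is real and nonnegative, and `|z| is valued in it. *)
Definition Cplx (R : realType) : numClosedFieldType := R[i].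

Definition unit_disk (R : realType) : set (Cplx R) := [set z | `|z| < 1].
Arguments unit_disk R : clear implicits.

(* Functions on the disk, or on a subset S of it, are represented by total
   functions whose values elsewhere are irrelevant.  The empty product N = 0 is
   allowed; f is then not a self-map of the disk. *)
Definition is_Blaschke (R : realType) (f : Cplx R -> Cplx R) : Prop :=
  exists (theta : R) (N : nat) (a : 'I_N -> Cplx R),
    (forall j, unit_disk R (a j)) /\
    forall z, unit_disk R z ->
      f z = (cos theta +i* sin theta) *
            \prod_(j < N) ((z - a j) / (1 - (a j)^* * z)).

Definition forward_orbit (T : Type) (f : T -> T) (z : T) : set T :=
  [set iter n f z | n in [set: nat]].

(* Complex differentiability at every point of the disk. *)
Definition holomorphic_on_disk (R : realType) (G : Cplx R -> Cplx R) : Prop :=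
  forall z, unit_disk R z -> derivable (G : Cplx R -> (Cplx R)^o) z 1.

Definition bounded_on_disk (R : realType) (G : Cplx R -> Cplx R) : Prop :=
  exists B : R, forall z, unit_disk R z -> `|G z| <= B%:C.

(* The least positive period, None standing for an infinite one. *)
Definition period (T : eqType) (f : T -> T) (z : T) : option nat :=
  match pselect (exists n, (0 < n)%N && (iter n f z == z)) with
  | left ex_n => Some (ex_minn ex_n)
  | right _ => None
  end.

(* C^n for n <= oo, embedded in l^2 as the sequences vanishing from index n on;
   C^oo is l^2 itself. *)
Definition in_Cpow (R : realType) (n : option nat) (c : nat -> Cplx R) : Prop :=
  (forall m j, n = Some m -> (m <= j)%N -> c j = 0) /\
  cvgn (series (fun j => `|c j| ^+ 2)).

(* Double series are summed along squares.  An infinite block K z w need not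
   define a bounded, or even everywhere defined, form on l^2: if f z = z ^+ 2,
   g = 0 and 0 < `|z| < 1, the entries of Delta f g M z z tend to M ^+ 2 and the
   series diverges to +oo at c j = 1 / (j + 1).  Hence the form is required to
   be nonnegative at those vectors where its series converge; these include all
   the finitely supported ones. *)
Definition psd_kernel (R : realType) (S : set (Cplx R))
    (n : Cplx R -> option nat)
    (K : Cplx R -> Cplx R -> nat -> nat -> Cplx R) : Prop :=
  forall (m : nat) (z : 'I_m -> Cplx R) (c : 'I_m -> nat -> Cplx R),
    (forall i, S (z i)) ->
    (forall i, in_Cpow (n (z i)) (c i)) ->
    forall V : 'I_m -> 'I_m -> Cplx R,
      (forall i k,
         (fun N : nat => \sum_(j < N) \sum_(l < N)
            K (z i) (z k) j l * c k l * (c i j)^*) @ \oo --> V i k) ->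
      0 <= \sum_(i < m) \sum_(k < m) V i k.

Definition alpha_sq (R : realType) (f : Cplx R -> Cplx R) : Cplx R :=
  (1 + `|f 0|) * (1 - `|f 0|)^-1.

(* The entry of index (j, l); only j < n_z and l < n_w are relevant, since the
   vectors of in_Cpow vanish at the other indices. *)
Definition Delta (R : realType) (f g : Cplx R -> Cplx R) (M : R)
    (z w : Cplx R) (j l : nat) : Cplx R :=
  M%:C ^+ 2 * alpha_sq f / (1 - iter j f z * (iter l f w)^*)
  - g z * (g w)^* / (1 - iter j.+1 f z * (iter l.+1 f w)^*).

(* Main.v *)
Require Import Defs.
From mathcomp Require Import all_boot all_order all_algebra.
From mathcomp Require Import complex.
From mathcomp Require Import all_classical all_reals all_analysis.
From mathcomp Require Import ring lra.
Import Order.TTheory GRing.Theory Num.Theory.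
Import numFieldNormedType.Exports.
Local Open Scope classical_set_scope.
Local Open Scope complex_scope.
Local Open Scope ring_scope.
Import Normc.
Set Implicit Arguments.
Unset Strict Implicit.
Unset Printing Implicit Defensive.

(* Write s(x, y) = 1 / (1 - x y^* ) for the Szego kernel.  Since g o f = g, the
   matrix kernel is nonnegative iff
     k(x, y) = c s(x, y) - g(x) g(y)^* s(f x, f y),   c = M^2 alpha^2,
   is a nonnegative kernel on S.

   If G extends g, put b = f 0, h = 1 / (1 - b^* f) and let F be f followed by
   the disk automorphism sending b to 0.  Then s(f x, f y) is
   (1 - |b|^2) h(x) h(y)^* s(F x, F y), and s - s(F, F) >= 0 because
   (1 - F F^* ) s - 1 >= 0 (Schur complement at 0); so k >= 0 for c large follows
   from Pick's theorem for the bounded function G h.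

   Conversely, a function with k >= 0 on a set W extends to W + {z0} with the
   same c: if b is f followed by the automorphism sending f z0 to 0, then
   k = Q - l l^* where Q = b b^* k + c (1 - b b^* ) s is still nonnegative on
   W + {z0}, and the functional l extends by Hahn-Banach.  By Zorn's lemma there
   is a G on the whole disk with k >= 0.  On the diagonal this bounds G, because
   (1 - |f|^2) / (1 - |z|^2) is bounded; and it makes G holomorphic, because it
   gives c s - G G^* >= 0, hence Lipschitz difference quotients.

   Integrals over the circle are replaced throughout by averages over the roots
   of unity of order 2^n, with n tending to infinity. *)

(** * Nonnegative kernels *)

(** Since [g] is constant along orbits, the entry of index [(j, l)] at [(z, w)] is
    [k(f^j z, f^l w)]. The form at given vectors is thus a limit of forms of [k] over finite pieces
    of orbits, and vectors supported at index 0 give [k] back.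

    The extension by one point has to keep [c], or the constant would degrade along the Zorn chain.
    The factor [b] vanishes at [z0], with two effects: [b b^* k] only involves points of W, where
    [k] is already nonnegative, and [Q] does not depend on the value still to be chosen at [z0].
    That value enters through [l] alone, linearly, and the inequality to be met says exactly that
    [l] is dominated by the seminorm of [Q].

    Averages over roots of unity have positive weights, so they preserve nonnegative kernels at
    every finite level. Only their convergence to the value given by Cauchy's formula needs an
    argument, and Goursat's lemma provides it. *)

Section Kernels.
Context {R : realType}.
Local Notation C := (Cplx R).

(** The order of [C] is partial, so the limit is handled through norms: [u n] equals its norm, hence
    so does [l]. *)
Lemma cvg_ge0 (u : nat -> C) (l : C) :
  (forall n, 0 <= u n) -> u n @[n --> \oo] --> l -> 0 <= l.
Proof.
move=> u0 ul.
have ul2 : `|u n| @[n --> \oo] --> (`|l| : C) by exact: cvg_norm.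
have uE : (fun n => `|u n|) = u by apply/funext => n; rewrite ger0_norm.
rewrite uE in ul2.
by rewrite (norm_cvg_unique (V := C^o) ul ul2).
Qed.

Lemma eq_cvgn (u v : nat -> C) (l : C) :
  u n @[n --> \oo] --> l -> (forall n, v n = u n) -> v n @[n --> \oo] --> l.
Proof. by move=> + /funext ->. Qed.

Lemma cvg_mull (c : C) (u : nat -> C) (l : C) :
  u n @[n --> \oo] --> l -> c * u n @[n --> \oo] --> c * l.
Proof. by move=> ul; exact: (cvgM (cvg_cst c) ul). Qed.

Lemma cvg_mulr (c : C) (u : nat -> C) (l : C) :
  u n @[n --> \oo] --> l -> u n * c @[n --> \oo] --> l * c.
Proof. by move=> ul; exact: (cvgM ul (cvg_cst c)). Qed.

Lemma cvg_sum_seq (I : eqType) (s : seq I) (u : I -> nat -> C) (l : I -> C) :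
  {in s, forall i, u i n @[n --> \oo] --> l i} ->
  \sum_(i <- s) u i n @[n --> \oo] --> \sum_(i <- s) l i.
Proof.
elim: s => [|i s IHs] ul.
  by under eq_fun do rewrite big_nil; rewrite big_nil; exact: cvg_cst.
under eq_fun do rewrite big_cons; rewrite big_cons; apply: cvgD.
  by apply: ul; rewrite mem_head.
by apply: IHs => j js; apply: ul; rewrite in_cons js orbT.
Qed.

(** Families are lists of pairs (point, coefficient). A point may occur several times, so families
    can be mapped and concatenated freely. *)
Definition qform (T : Type) (k : T -> T -> C) (s : seq (T * C)) : C :=
  \sum_(x <- s) \sum_(y <- s) k x.1 y.1 * y.2 * x.2^*.

Definition psd (T : eqType) (A : set T) (k : T -> T -> C) : Prop :=
  forall s : seq (T * C), {in s, forall x, A x.1} -> 0 <= qform k s.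

Lemma eq_qform (T : eqType) (A : set T) (k k' : T -> T -> C) s :
  {in s, forall x, A x.1} -> (forall x y, A x -> A y -> k x y = k' x y) ->
  qform k s = qform k' s.
Proof.
move=> sA kk'; apply: eq_big_seq => x xs; apply: eq_big_seq => y ys.
by rewrite kk' //; apply: sA.
Qed.

Lemma qformD (T : Type) (k k' : T -> T -> C) s :
  qform (fun x y => k x y + k' x y) s = qform k s + qform k' s.
Proof.
rewrite /qform -big_split; apply: eq_bigr => x _.
by rewrite -big_split; apply: eq_bigr => y _; rewrite !mulrDl.
Qed.

Lemma qformZ (T : Type) (a : C) (k : T -> T -> C) s :
  qform (fun x y => a * k x y) s = a * qform k s.
Proof.
rewrite /qform mulr_sumr; apply: eq_bigr => x _.
by rewrite mulr_sumr; apply: eq_bigr => y _; rewrite !mulrA.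
Qed.

Lemma qform_rank1 (T : Type) (a : T -> C) s :
  qform (fun x y => a x * (a y)^*) s = `|\sum_(x <- s) a x.1 * x.2^*| ^+ 2.
Proof.
rewrite normCK rmorph_sum mulr_suml; apply: eq_bigr => x _.
rewrite mulr_sumr; apply: eq_bigr => y _.
by rewrite rmorphM /= conjCK; ring.
Qed.

Lemma eq_psd (T : eqType) (A : set T) (k k' : T -> T -> C) :
  (forall x y, A x -> A y -> k x y = k' x y) -> psd A k -> psd A k'.
Proof. by move=> kk' kA s sA; rewrite -(eq_qform sA kk') kA. Qed.

Lemma sub_psd (T : eqType) (A B : set T) (k : T -> T -> C) :
  A `<=` B -> psd B k -> psd A k.
Proof. by move=> AB kB s sA; apply: kB => x /sA; exact: AB. Qed.

Lemma psdD (T : eqType) (A : set T) (k k' : T -> T -> C) :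
  psd A k -> psd A k' -> psd A (fun x y => k x y + k' x y).
Proof. by move=> kA k'A s sA; rewrite qformD addr_ge0 ?kA ?k'A. Qed.

Lemma psdZ (T : eqType) (A : set T) (a : C) (k : T -> T -> C) :
  0 <= a -> psd A k -> psd A (fun x y => a * k x y).
Proof. by move=> a0 kA s sA; rewrite qformZ mulr_ge0 ?kA. Qed.

Lemma psd_sum (T I : eqType) (A : set T) (r : seq I) (k : I -> T -> T -> C) :
  (forall i, psd A (k i)) -> psd A (fun x y => \sum_(i <- r) k i x y).
Proof.
move=> kA; elim: r => [|i r IHr].
  by move=> s sA; rewrite /qform big1 // => x _; rewrite big1 // => y _;
    rewrite big_nil !mul0r.
by apply: eq_psd (psdD (kA i) IHr) => x y _ _; rewrite big_cons.
Qed.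

Lemma psd_rank1 (T : eqType) (A : set T) (a : T -> C) :
  psd A (fun x y => a x * (a y)^*).
Proof. by move=> s _; rewrite qform_rank1 exprn_ge0. Qed.

Lemma qform_map (T T' : Type) (k : T -> T -> C) (h : T' -> T) (a : T' -> C) s :
  qform k [seq (h x.1, (a x.1)^* * x.2) | x <- s] =
  qform (fun x y => a x * k (h x) (h y) * (a y)^*) s.
Proof.
rewrite /qform big_map; apply: eq_bigr => x _.
rewrite big_map; apply: eq_bigr => y _ /=.
by rewrite rmorphM /= conjCK; ring.
Qed.

Lemma psd_congr (T T' : eqType) (A : set T) (A' : set T') (k : T -> T -> C)
    (h : T' -> T) (a : T' -> C) :
  (forall x, A' x -> A (h x)) -> psd A k ->
  psd A' (fun x y => a x * k (h x) (h y) * (a y)^*).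
Proof.
move=> hA kA s sA; rewrite -qform_map; apply: kA => _ /mapP[x xs ->] /=.
by apply: hA; apply: sA.
Qed.

Lemma psd_comp (T T' : eqType) (A : set T) (A' : set T') (k : T -> T -> C)
    (h : T' -> T) :
  (forall x, A' x -> A (h x)) -> psd A k -> psd A' (fun x y => k (h x) (h y)).
Proof.
move=> hA kA; apply: eq_psd (psd_congr (fun=> 1) hA kA) => x y _ _.
by rewrite rmorph1 mulr1 mul1r.
Qed.

Lemma psd_mulr1 (T : eqType) (A : set T) (a : T -> C) (k : T -> T -> C) :
  psd A k -> psd A (fun x y => a x * k x y * (a y)^*).
Proof. by move=> kA; apply: (psd_congr (h := id)) kA. Qed.

Lemma psd_cvg (T : eqType) (A : set T) (k : nat -> T -> T -> C)
    (l : T -> T -> C) :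
  (forall n, psd A (k n)) ->
  (forall x y, A x -> A y -> k n x y @[n --> \oo] --> l x y) -> psd A l.
Proof.
move=> kA kl s sA; apply: (@cvg_ge0 (fun n => qform (k n) s)) => [n|].
  exact: kA.
apply: cvg_sum_seq => x xs; apply: cvg_sum_seq => y ys.
by do 2![apply: cvg_mulr]; apply: kl; apply: sA.
Qed.

(* Schur complement of the entry [k o o = 1]: the family is completed by the
   opposite of the sum of its coefficients, placed at [o]. *)
Lemma psd_subr1 (T : eqType) (A : set T) (k : T -> T -> C) (o : T) :
  A o -> k o o = 1 -> (forall x, A x -> k x o = 1 /\ k o x = 1) ->
  psd A k -> psd A (fun x y => k x y - 1).
Proof.
move=> Ao koo ko kA s sA; pose d := \sum_(x <- s) x.2.
have /kA : {in (o, - d) :: s, forall x, A x.1}.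
  by move=> x; rewrite in_cons => /orP[/eqP -> //|]; exact: sA.
suff -> : qform k ((o, - d) :: s) = qform (fun x y => k x y - 1) s by [].
have dE : \sum_(x <- s) x.2^* = d^* by rewrite rmorph_sum.
have -> : qform (fun x y => k x y - 1) s = qform k s - d * d^*.
  rewrite (@qformD _ k (fun _ _ => -1)) {2}/qform; congr (_ + _).
  rewrite -dE mulr_sumr -sumrN; apply: eq_bigr => x _.
  by rewrite -mulr_suml -mulr_sumr mulN1r mulNr.
rewrite /qform big_cons /= !big_cons /= koo -/(qform k s).
have -> : \sum_(y <- s) k o y.1 * y.2 * (- d)^* = - (d * d^*).
  rewrite -mulr_suml rmorphN mulrN; congr (- (_ * _)).
  by rewrite /d big_seq [RHS]big_seq; apply: eq_bigr => y ys; rewrite (ko _ (sA _ ys)).2 mul1r.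
under eq_bigr do rewrite big_cons /=.
rewrite big_split /= -/(qform k s).
have -> : \sum_(x <- s) k x.1 o * - d * x.2^* = - (d * d^*).
  rewrite -dE mulr_sumr -[RHS]sumrN big_seq [RHS]big_seq; apply: eq_bigr => y ys.
  by rewrite (ko _ (sA _ ys)).1; ring.
by rewrite rmorphN; ring.
Qed.

End Kernels.

(** * Goursat's lemma for Riemann sums *)

Lemma exp2_gt (R : realType) (x : R) : exists n, x < 2 ^+ n.
Proof.
have [x0|x0] := leP 0 x; last by exists 0%N; rewrite expr0; lra.
exists (Num.bound x); apply: lt_trans (archi_boundP x0) _.
by rewrite -natrX ltr_nat ltn_expl.
Qed.

Lemma nested_itv (R : realType) (x a : nat -> R) :
  (forall n, 0 <= a n) -> (forall n, x n <= x n.+1) ->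
  (forall n, x n.+1 + a n.+1 <= x n + a n) ->
  exists s, forall n, x n <= s <= x n + a n.
Proof.
move=> a0 xS aS.
have xD n m : x n <= x (n + m)%N.
  by elim: m => [|m IHm]; rewrite ?addn0// addnS (le_trans IHm).
have aD n m : x (n + m)%N + a (n + m)%N <= x n + a n.
  by elim: m => [|m IHm]; rewrite ?addn0// addnS (le_trans _ IHm).
have xa m n : x m <= x n + a n.
  have := xD m n; have := aD n m; have := a0 (n + m)%N; rewrite addnC; lra.
exists (sup (range x)) => n; apply/andP; split.
  apply: ub_le_sup; last by exists n.
  by exists (x 0 + a 0)%R => _ [m _ <-].
by apply: ge_sup => [|_ [m _ <-] //]; exists (x n); exists n.
Qed.

(** Compactness by bisection: a rectangle violating [P] has a quarter violating it, and the nested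
    bad quarters shrink to a point [(s, t)] where the local hypothesis is contradicted. *)
Lemma rectangle_bisection (R : realType) (P : R -> R -> R -> R -> Prop)
    (x0 y0 a0 b0 : R) :
  0 < a0 -> 0 < b0 ->
  (forall x y a b, 0 < a -> 0 < b ->
    P x y (a / 2) (b / 2) -> P (x + a / 2) y (a / 2) (b / 2) ->
    P x (y + b / 2) (a / 2) (b / 2) ->
    P (x + a / 2) (y + b / 2) (a / 2) (b / 2) -> P x y a b) ->
  (forall s t, x0 <= s <= x0 + a0 -> y0 <= t <= y0 + b0 ->
    exists2 d : R, 0 < d & forall x y a b, 0 < a -> 0 < b -> a + b < d ->
      x <= s <= x + a -> y <= t <= y + b ->
      x0 <= x -> x + a <= x0 + a0 -> y0 <= y -> y + b <= y0 + b0 ->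
      P x y a b) ->
  P x0 y0 a0 b0.
Proof.
move=> a0_gt0 b0_gt0 Psplit Ploc; apply: contrapT => nP.
pose Q (q : R * R * R * R) := P q.1.1.1 q.1.1.2 q.1.2 q.2.
pose quarter (i j : bool) (q : R * R * R * R) :=
  (q.1.1.1 + i%:R * (q.1.2 / 2), q.1.1.2 + j%:R * (q.2 / 2),
   q.1.2 / 2, q.2 / 2).
(* The conditions on [q] stay inside the existential, so that [choice] yields a total successor
   function. *)
have next q : exists q', 0 < q.1.2 -> 0 < q.2 -> ~ Q q ->
    ~ Q q' /\ exists i j, q' = quarter i j q.
  apply: contrapT => /forallNP noq.
  have Qq i j : [/\ 0 < q.1.2, 0 < q.2 & ~ Q q] /\ Q (quarter i j q).
    have := noq (quarter i j q).
    move=> /not_implyP[q1 /not_implyP[q2 /not_implyP[q3 nn]]].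
    split=> //; apply: contrapT => nQ; apply: nn; split=> //.
    by exists i, j.
  have [[q1 q2 nQ] _] := Qq true true; apply: nQ.
  have Qij i j := (Qq i j).2.
  move: (Qij false false) (Qij true false) (Qij false true) (Qij true true).
  rewrite /Q /quarter /= !mul0r !mul1r !addr0; exact: Psplit.
have [nxt nxtP] := choice next.
pose q n := iter n nxt (x0, y0, a0, b0).
have qP n : [/\ 0 < (q n).1.2, 0 < (q n).2 & ~ Q (q n)].
  elim: n => [|n [q1 q2 q3]]; first by split.
  have [? [i [j]]] := nxtP _ q1 q2 q3; rewrite /q iterS -/(q n) => e.
  by split => //; rewrite e /= divr_gt0.
have qS n : exists i j, q n.+1 = quarter i j (q n).
  by have [q1 q2 q3] := qP n; have [] := nxtP _ q1 q2 q3.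
have half (i : bool) (u v : R) : 0 < v ->
    u <= u + i%:R * (v / 2) /\ u + i%:R * (v / 2) + v / 2 <= u + v.
  by move=> v0; case: i => /=; split; lra.
have sizeE n : (q n).1.2 + (q n).2 = (a0 + b0) / 2 ^+ n.
  elim: n => [|n IHn]; first by rewrite expr0 divr1.
  have [i [j ->]] := qS n; rewrite /= -mulrDl IHn exprS.
  by field; rewrite expf_neq0.
have [s sP] : exists s, forall n, (q n).1.1.1 <= s <= (q n).1.1.1 + (q n).1.2.
  apply: nested_itv => n; first by have [/ltW] := qP n.
    by have [q1 _ _] := qP n; have [i [j ->]] := qS n; have [] := half i (q n).1.1.1 _ q1.
  by have [q1 _ _] := qP n; have [i [j ->]] := qS n; have [] := half i (q n).1.1.1 _ q1.
have [t tP] : exists t, forall n, (q n).1.1.2 <= t <= (q n).1.1.2 + (q n).2.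
  apply: nested_itv => n; first by have [_ /ltW] := qP n.
    by have [_ q1 _] := qP n; have [i [j ->]] := qS n; have [] := half j (q n).1.1.2 _ q1.
  by have [_ q1 _] := qP n; have [i [j ->]] := qS n; have [] := half j (q n).1.1.2 _ q1.
have inside n : [/\ x0 <= (q n).1.1.1, (q n).1.1.1 + (q n).1.2 <= x0 + a0,
                    y0 <= (q n).1.1.2 & (q n).1.1.2 + (q n).2 <= y0 + b0].
  elim: n => [|n [i1 i2 i3 i4]]; first by split.
  have [q1 q2 _] := qP n; have [i [j ->]] := qS n => /=.
  have := half i (q n).1.1.1 _ q1; have := half j (q n).1.1.2 _ q2.
  by move=> [? ?] [? ?]; split; lra.
have [d d0 dP] := Ploc s t (sP 0) (tP 0).
have [n nP'] := exp2_gt ((a0 + b0) / d).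
have [q1 q2 nQ] := qP n; have [i1 i2 i3 i4] := inside n; apply: nQ.
apply: dP => //; rewrite sizeE ltr_pdivrMr ?exprn_gt0//.
by rewrite mulrC -ltr_pdivrMr.
Qed.

Section Goursat.
Context {R : realType}.
Local Notation C := (Cplx R).
Local Notation I := (0 +i* 1 : C).

(** With a power of two as number of nodes, a mean of level [n.+1] is exactly the average of the
    means of level [n] over the two halves. *)
Definition dyadic_mean n (h : R -> C) (x a : R) : C :=
  (2 ^+ n)^-1 * \sum_(k < 2 ^ n) h (x + a * (k%:R / 2 ^+ n)).

Lemma dyadic_meanS n h x a :
  dyadic_mean n.+1 h x a =
  (dyadic_mean n h x (a / 2) + dyadic_mean n h (x + a / 2) (a / 2)) / 2.
Proof.
rewrite /dyadic_mean -mulrDr.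
have -> : \sum_(k < 2 ^ n.+1) h (x + a * (k%:R / 2 ^+ n.+1)) =
    \sum_(k < 2 ^ n) h (x + a / 2 * (k%:R / 2 ^+ n)) +
    \sum_(k < 2 ^ n) h (x + a / 2 + a / 2 * (k%:R / 2 ^+ n)).
  have -> : (2 ^ n.+1 = 2 ^ n + 2 ^ n)%N by rewrite expnS mul2n addnn.
  rewrite big_split_ord /=; congr (_ + _); apply: eq_bigr => k _; congr h.
    by rewrite exprS; field; rewrite expf_neq0.
  by rewrite natrD natrX exprS; field; rewrite expf_neq0.
by rewrite exprS invfM; ring.
Qed.

Lemma dyadic_meanD n h h' x a :
  dyadic_mean n (fun t => h t + h' t) x a =
  dyadic_mean n h x a + dyadic_mean n h' x a.
Proof. by rewrite /dyadic_mean big_split /= mulrDr. Qed.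

Lemma eq_dyadic_mean n h h' x a :
  (forall t, h t = h' t) -> dyadic_mean n h x a = dyadic_mean n h' x a.
Proof. by move=> hh'; congr (_ * _); apply: eq_bigr => k _. Qed.

Lemma dyadic_mean_cst n c x a : dyadic_mean n (fun=> c) x a = c.
Proof.
rewrite /dyadic_mean sumr_const card_ord -[X in _ * X]mulr_natl natrX.
rewrite mulrA mulVf ?mul1r // expf_neq0 // pnatr_eq0.
Qed.

Lemma normc_real (x : R) : normc (x%:C : C) = `|x|.
Proof. by rewrite /normc /= expr0n addr0 sqrtr_sqr. Qed.

Lemma normcI : normc I = 1.
Proof. by rewrite /normc /= expr0n add0r expr1n sqrtr1. Qed.

Lemma normc_dyadic_mean n h x a e : 0 <= a ->
  (forall t, x <= t <= x + a -> normc (h t) <= e) ->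
  normc (dyadic_mean n h x a) <= e.
Proof.
move=> a0 he; rewrite /dyadic_mean normcM.
have -> : normc ((2 ^+ n)^-1 : C) = (2 ^+ n)^-1.
  have -> : ((2 ^+ n)^-1 : C) = ((2 ^+ n)^-1)%:C.
    by rewrite fmorphV rmorphXn rmorph_nat.
  by rewrite normc_real ger0_norm// invr_ge0 exprn_ge0.
rewrite mulrC ler_pdivrMr ?exprn_gt0//.
apply: (@le_trans _ _ (\sum_(k < 2 ^ n) e)); last first.
  by rewrite sumr_const card_ord -[leLHS]mulr_natr natrX.
apply: (@le_trans _ _ (\sum_(k < 2 ^ n) normc (h (x + a * (k%:R / 2 ^+ n))))).
  elim/big_ind2 : _ => [|u v u' v' uv uv'|//]; first by rewrite normc0.
  by apply: le_trans (le_normcD _ _) _; exact: lerD.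
apply: ler_sum => k _; apply: he.
have k0 : 0 <= (k%:R / 2 ^+ n : R) by rewrite divr_ge0// exprn_ge0.
have k1 : (k%:R / 2 ^+ n : R) <= 1.
  by rewrite ler_pdivrMr ?exprn_gt0// mul1r -natrX ler_nat ltnW.
by rewrite lerDl mulr_ge0//= lerD2l ler_piMr.
Qed.

(* Left-endpoint Riemann sum of [H(s, t) (ds + i dt)] along the boundary of
   [x, x + a] x [y, y + b]. *)
Definition circulation n (H : R -> R -> C) (x y a b : R) : C :=
  a%:C * (dyadic_mean n (H^~ y) x a - dyadic_mean n (H^~ (y + b)) x a) +
  I * b%:C * (dyadic_mean n (H (x + a)) y b - dyadic_mean n (H x) y b).

(** Two quarters sample their common edge at the same nodes, so the inner edges cancel exactly. *)
Lemma circulationS n H x y a b :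
  circulation n.+1 H x y a b =
    circulation n H x y (a / 2) (b / 2) +
    circulation n H (x + a / 2) y (a / 2) (b / 2) +
    circulation n H x (y + b / 2) (a / 2) (b / 2) +
    circulation n H (x + a / 2) (y + b / 2) (a / 2) (b / 2).
Proof.
rewrite /circulation !dyadic_meanS.
have -> : y + b / 2 + b / 2 = y + b by field.
have -> : x + a / 2 + a / 2 = x + a by field.
have half (u : R) : (u / 2)%:C = u%:C / 2 :> C by rewrite fmorph_div rmorph_nat.
by rewrite !half; field.
Qed.

Lemma circulationD n H H' x y a b :
  circulation n (fun s t => H s t + H' s t) x y a b =
  circulation n H x y a b + circulation n H' x y a b.
Proof. by rewrite /circulation !dyadic_meanD; ring. Qed.

(** Between opposite edges the integrand changes by the constants [c I b] and [c a], whose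
    contributions [- a (c I b)] and [I b (c a)] cancel. *)
Lemma circulation_affine n (A c : C) s t x y a b :
  circulation n (fun s' t' => A + c * ((s' - s)%:C + I * (t' - t)%:C)) x y a b
  = 0.
Proof.
rewrite /circulation.
have -> : dyadic_mean n (fun s' => A + c * ((s' - s)%:C + I * (y + b - t)%:C)) x a
  = dyadic_mean n (fun s' => A + c * ((s' - s)%:C + I * (y - t)%:C)) x a
    + c * I * b%:C.
  rewrite -[c * I * b%:C](dyadic_mean_cst n _ x a) -dyadic_meanD.
  by apply: eq_dyadic_mean => s'; rewrite !rmorphB rmorphD /=; ring.
have -> : dyadic_mean n (fun t' => A + c * ((x + a - s)%:C + I * (t' - t)%:C)) y b
  = dyadic_mean n (fun t' => A + c * ((x - s)%:C + I * (t' - t)%:C)) y b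
    + c * a%:C.
  rewrite -[c * a%:C](dyadic_mean_cst n _ y b) -dyadic_meanD.
  by apply: eq_dyadic_mean => t'; rewrite !rmorphB rmorphD /=; ring.
ring.
Qed.

Lemma normc_circulation n H x y a b e : 0 <= a -> 0 <= b ->
  (forall s t, x <= s <= x + a -> y <= t <= y + b -> normc (H s t) <= e) ->
  normc (circulation n H x y a b) <= 2 * (a + b) * e.
Proof.
move=> a0 b0 He; rewrite /circulation.
have x1 : x <= x <= x + a by lra.
have x2 : x <= x + a <= x + a by lra.
have y1 : y <= y <= y + b by lra.
have y2 : y <= y + b <= y + b by lra.
have sub (u v : C) : normc u <= e -> normc v <= e -> normc (u - v) <= 2 * e.
  by move=> ? ?; apply: le_trans (le_normcD _ _) _; rewrite normcN; lra.
apply: le_trans (le_normcD _ _) _.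
rewrite !normcM !normc_real !ger0_norm// normcI mul1r.
rewrite [leRHS](_ : _ = a * (2 * e) + b * (2 * e)); last by ring.
by apply: lerD; apply: ler_wpM2l => //; apply: sub;
  apply: normc_dyadic_mean => // t ?; apply: He.
Qed.

(* A circulation at level [n.+1] is exactly the sum of four circulations at level
   [n], and that of an affine integrand vanishes at every level, so Goursat's
   bisection works with the sums themselves. *)
Lemma Goursat_rectangle (H : R -> R -> C) (x0 y0 a0 b0 : R) :
  0 < a0 -> 0 < b0 ->
  (forall s t, x0 <= s <= x0 + a0 -> y0 <= t <= y0 + b0 ->
    exists c : C, forall e : R, 0 < e -> exists2 d : R, 0 < d &
      forall s' t', `|s' - s| < d -> `|t' - t| < d ->
      normc (H s' t' - H s t - c * ((s' - s)%:C + I * (t' - t)%:C))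
        <= e * (`|s' - s| + `|t' - t|)) ->
  forall e : R, 0 < e -> \forall n \near \oo,
    normc (circulation n H x0 y0 a0 b0) <= e.
Proof.
move=> a0_gt0 b0_gt0 Hdiff e e0.
(* A bound proportional to the square of [a + b] is divided by exactly four on each quarter, hence
   is compatible with bisection. *)
pose e' := e / (a0 + b0) ^+ 2.
have e'0 : 0 < e' by rewrite divr_gt0// exprn_gt0// addr_gt0.
suff : \forall n \near \oo,
    normc (circulation n H x0 y0 a0 b0) <= e' * (a0 + b0) ^+ 2.
  by rewrite /e' divfK// expf_neq0// gt_eqF// addr_gt0.
pose P x y a b := \forall n \near \oo,
    normc (circulation n H x y a b) <= e' * (a + b) ^+ 2.
apply: (@rectangle_bisection _ P) => // [x y a b _ _ P1 P2 P3 P4|s t sP tP].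
  suff : \forall n \near \oo,
      normc (circulation n.+1 H x y a b) <= e' * (a + b) ^+ 2.
    by move=> [N _ NP]; exists N.+1 => // -[//|n] /= Nn; exact: NP.
  near=> n; rewrite circulationS.
  have q1 : normc (circulation n H x y (a / 2) (b / 2)) <=
    e' * (a / 2 + b / 2) ^+ 2 by near: n.
  have q2 : normc (circulation n H (x + a / 2) y (a / 2) (b / 2)) <=
    e' * (a / 2 + b / 2) ^+ 2 by near: n.
  have q3 : normc (circulation n H x (y + b / 2) (a / 2) (b / 2)) <=
    e' * (a / 2 + b / 2) ^+ 2 by near: n.
  have q4 : normc (circulation n H (x + a / 2) (y + b / 2) (a / 2) (b / 2)) <=
    e' * (a / 2 + b / 2) ^+ 2 by near: n.
  apply: le_trans (le_normcD _ _) _.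
  rewrite (_ : e' * (a + b) ^+ 2 = e' * (a / 2 + b / 2) ^+ 2 +
    e' * (a / 2 + b / 2) ^+ 2 + e' * (a / 2 + b / 2) ^+ 2 +
    e' * (a / 2 + b / 2) ^+ 2); last by field.
  apply: lerD q4; apply: le_trans (le_normcD _ _) _.
  apply: lerD q3; apply: le_trans (le_normcD _ _) _; exact: lerD.
have [c cP] := Hdiff s t sP tP.
(* The half absorbs the factor 2 of [normc_circulation]. *)
have e'2 : 0 < e' / 2 by rewrite divr_gt0.
have [d d0 dP] := cP _ e'2.
exists d => // x y a b a1 b1 ab xs yt _ _ _ _; near=> n.
pose L s' t' := H s t + c * ((s' - s)%:C + I * (t' - t)%:C).
have -> : circulation n H x y a b =
    circulation n (fun s' t' => L s' t' + (H s' t' - L s' t')) x y a b.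
  by rewrite /circulation; congr (_ * (_ - _) + _ * (_ - _));
    apply: eq_dyadic_mean => r; rewrite /= [RHS]addrC subrK.
rewrite circulationD circulation_affine add0r.
apply: le_trans (normc_circulation _ (ltW a1) (ltW b1) (e := e' / 2 * (a + b)) _) _.
  move=> s' t' s'P t'P.
  have ds : `|s' - s| <= a by rewrite ler_norml; lra.
  have dt : `|t' - t| <= b by rewrite ler_norml; lra.
  rewrite /L opprD addrA; apply: le_trans (dP s' t' _ _) _; [lra|lra|].
  by rewrite ler_wpM2l ?lerD// ltW// divr_gt0.
by rewrite le_eqVlt; apply/orP; left; apply/eqP; field.
Unshelve. all: by end_near. Qed.

End Goursat.

(** * Averages over circles *)

Lemma is_derive_littleo (K : numFieldType) (f : K -> K) (z c : K) :
  is_derive z 1 (f : K -> K^o) c ->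
  forall e : K, 0 < e -> exists2 d : K, 0 < d &
    forall w, `|w - z| < d -> `|f w - f z - c * (w - z)| <= e * `|w - z|.
Proof.
move=> [df <-] e e0; have /cvg_ex [l hl] := df.
have lE : 'D_1 (f : K -> K^o) z = l by exact: norm_cvg_lim hl.
rewrite lE; move/cvgrPdist_le : hl => /(_ e e0).
rewrite near_withinE => /nbhs_ballP [d /= d0 dP]; exists d => // w wd.
have [->|wz] := eqVneq w z; first by rewrite !subrr mulr0 subrr normr0 mulr0.
have wz0 : w - z != 0 by rewrite subr_eq0.
have wb : ball (0 : K^o) d (w - z) by rewrite -ball_normE /ball_ /= distrC subr0.
have := dP _ wb wz0.
have e1 : (w - z) *: (1 : K^o) = w - z := mulr1 _.
rewrite /= e1 subrK => h.
rewrite -ler_pdivrMr ?normr_gt0// -normf_div; rewrite distrC in h.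
by congr (`|_| <= _) : h; rewrite /GRing.scale /=; field.
Qed.

Section Polar.
Context {R : realType}.
Local Notation C := (Cplx R).
Local Notation I := (0 +i* 1 : C).

(** Estimates use the real-valued [normc], on which [lra] works; this identity links it to the
    products [z * z^*] of the kernels. *)
Lemma normcCK (z : C) : (normc z ^+ 2)%:C = z * z^*.
Proof. by rewrite -normCK; exact: rmorphXn. Qed.

Lemma normc_ge0 (z : C) : 0 <= normc z.
Proof. by case: z => *; exact: sqrtr_ge0. Qed.

Lemma normc_unit (z : C) : z * z^* = 1 -> normc z = 1.
Proof.
move=> zz; apply/eqP; rewrite -(@eqrXn2 _ 2) ?normc_ge0// expr1n.
by apply/eqP/complexI; rewrite normcCK.
Qed.

Lemma normcB (u v : C) : normc (u - v) = normc (v - u).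
Proof. by rewrite -normcN opprB. Qed.

Lemma gt0_complex (e : C) : 0 < e -> exists2 r : R, 0 < r & e = r%:C.
Proof.
by case: e => a b; rewrite ltcE /= => /andP[/eqP -> a0]; exists a.
Qed.

Lemma normc_cvgP (u : nat -> C) (l : C) :
  (forall e : R, 0 < e -> \forall n \near \oo, normc (u n - l) <= e) <->
  u n @[n --> \oo] --> l.
Proof.
split=> [ul|/cvgrPdist_le ul e e0].
  apply/cvgrPdist_le => _ /gt0_complex[e e0 ->].
  by apply: filterS (ul _ e0) => n; rewrite distrC -lecR.
by have := ul e%:C; rewrite ltcR => /(_ e0); apply: filterS => n;
  rewrite distrC -lecR.
Qed.

Lemma derivable_littleo (f : C -> C) (z : C) : derivable (f : C -> C^o) z 1 ->
  exists c : C, forall e : R, 0 < e -> exists2 d : R, 0 < d &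
    forall w, normc (w - z) < d ->
      normc (f w - f z - c * (w - z)) <= e * normc (w - z).
Proof.
move=> df; exists ('D_1 (f : C -> C^o) z) => e e0.
have e0' : 0 < e%:C :> C by rewrite ltcR.
have [_ /gt0_complex[d d0 ->] dP] := is_derive_littleo (DeriveDef df erefl) e0'.
exists d => // w wd.
by have {}dP := dP w; rewrite -lecR rmorphM; apply: dP; rewrite ltcR.
Qed.

Lemma derivable_cont (f : C -> C) (z : C) : derivable (f : C -> C^o) z 1 ->
  forall e : R, 0 < e -> exists2 d : R, 0 < d &
    forall w, normc (w - z) < d -> normc (f w - f z) <= e.
Proof.
move=> /derivable_littleo [c /(_ _ ltr01)[d d0 dP]] e e0.
have c0 : 0 <= normc c by exact: normc_ge0.
exists (Num.min d (e / (normc c + 1))).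
  by rewrite lt_min d0 divr_gt0// ltr_wpDl.
move=> w; rewrite lt_min => /andP[/dP wd]; rewrite ltr_pdivlMr ?ltr_wpDl// => we.
rewrite -[_ - _](subrK (c * (w - z))).
by apply: le_trans (le_normcD _ _) _; rewrite normcM; lra.
Qed.

Definition circ_pt (t : R) : C := cos t +i* sin t.

Lemma circ_ptD s t : circ_pt (s + t) = circ_pt s * circ_pt t.
Proof.
rewrite /circ_pt cosD sinD; apply/eqP; rewrite eq_complex /=.
by rewrite eqxx /= addrC [X in _ + X]mulrC [X in X + _]mulrC addrC eqxx.
Qed.

Lemma circ_pt2pi : circ_pt (2 * pi) = circ_pt 0.
Proof. by rewrite mulr_natl /circ_pt cos2pi sin2pi cos0 sin0. Qed.

Lemma normc_circ_pt t : normc (circ_pt t) = 1.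
Proof. by rewrite /normc /circ_pt cos2Dsin2 sqrtr1. Qed.

(** First-order expansion at 0 of the complex exponential of [x + i y], from the derivatives of the
    real exponential, cosine and sine. *)
Lemma exp_circ_littleo (e : R) : 0 < e -> exists2 d : R, 0 < d &
  forall x y, `|x| < d -> `|y| < d ->
    (* The 5 below is the total weight of [|y|]: 4 from the product [(1 + x) u] and 1 from [x y]. *)
    normc ((expR x)%:C * circ_pt y - 1 - (x%:C + I * y%:C)) <= e * (`|x| + `|y|).
Proof.
move=> e0; pose e' := e / 5; have e'0 : 0 < e' by rewrite divr_gt0.
have [d1 d10 dP1] := is_derive_littleo (is_derive_expR (0 : R)) e'0.
have [d2 d20 dP2] := is_derive_littleo (is_derive_cos (0 : R)) e'0.
have [d3 d30 dP3] := is_derive_littleo (is_derive_sin (0 : R)) e'0.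
exists (Num.min (Num.min d1 d2) (Num.min d3 (Num.min 1 e'))).
  by rewrite !lt_min d10 d20 d30 ltr01 e'0.
move=> x y; rewrite !lt_min => /andP[/andP[x1 _] /andP[_ /andP[x2 x3]]].
move=> /andP[/andP[_ y1] /andP[y2 /andP[_ y3]]].
have := dP1 x; rewrite subr0 => /(_ x1); rewrite expR0 mul1r => {}dP1.
have := dP2 y; rewrite subr0 => /(_ y1).
rewrite cos0 sin0 oppr0 mul0r subr0 => {}dP2.
have := dP3 y; rewrite subr0 => /(_ y2).
rewrite cos0 sin0 mul1r subr0 => {}dP3.
pose u : C := (cos y - 1)%:C + I * (sin y - y)%:C.
have uE : u = circ_pt y - 1 - I * y%:C.
  have -> : circ_pt y = (cos y)%:C + I * (sin y)%:C := complexE _.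
  by rewrite /u !rmorphB rmorph1; ring.
have nu : normc u <= 2 * e' * `|y|.
  apply: le_trans (le_normcD _ _) _; rewrite normcM normcI mul1r !normc_real.
  by lra.
have -> : (expR x)%:C * circ_pt y - 1 - (x%:C + I * y%:C) =
    (expR x - 1 - x)%:C * circ_pt y + ((1 + x)%:C * u + x%:C * (I * y%:C)).
  by rewrite uE !rmorphB rmorphD /= rmorph1; ring.
apply: le_trans (le_normcD _ _) _.
have := le_normcD ((1 + x)%:C * u : C) (x%:C * (I * y%:C) : C).
rewrite !normcM normc_circ_pt normcI !normc_real mulr1 mul1r => h.
have x4 : `|1 + x| <= 2 by have := ler_normD 1 x; rewrite normr1; lra.
have h2 : `|1 + x| * normc u <= 2 * (2 * e' * `|y|).
  by apply: ler_pM => //; case: (u) => *; exact: sqrtr_ge0.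
have h3 : `|x| * `|y| <= e' * `|y| by apply: ler_wpM2r => //; exact: ltW.
have h4 : 0 <= e' * `|x| by rewrite mulr_ge0// ltW.
have h5 : e * (`|x| + `|y|) = 5 * (e' * `|x|) + 5 * (e' * `|y|).
  by rewrite /e'; field.
have h6 : 0 <= e' * `|y| by rewrite mulr_ge0// ltW.
lra.
Qed.

(** Chain rule for [f] composed with the exponential, in the form required by [Goursat_rectangle]:
    log-polar coordinates turn annuli into rectangles. *)
Lemma derivable_polar (f : C -> C) (s t : R) :
  derivable (f : C -> C^o) ((expR s)%:C * circ_pt t) 1 ->
  exists c : C, forall e : R, 0 < e -> exists2 d : R, 0 < d &
    forall s' t', `|s' - s| < d -> `|t' - t| < d ->
    normc (f ((expR s')%:C * circ_pt t') - f ((expR s)%:C * circ_pt t) -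
           c * ((s' - s)%:C + I * (t' - t)%:C))
      <= e * (`|s' - s| + `|t' - t|).
Proof.
set w := _ * circ_pt t => /derivable_littleo[c cP].
exists (c * w) => e e0; pose W := normc w.
have W0 : 0 <= W by exact: normc_ge0.
have c0 : 0 <= normc c by exact: normc_ge0.
have cW0 : 0 <= normc c * W by rewrite mulr_ge0.
have W1 : 0 < W + 1 by lra.
have cW1 : 0 < normc c * W + 1 by lra.
(* The increment [w' - w] is at most [2 W X], so the remainder of [f] costs at most [e / 2 * X]; the
   remainder [r] of the exponential gets the other half. [W + 1] avoids a division by zero. *)
have e10 : 0 < e / (4 * (W + 1)) by rewrite divr_gt0// mulr_gt0.
have [d1 d10 dP1] := cP _ e10.
have e20 : 0 < Num.min 1 (e / (2 * (normc c * W + 1))).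
  by rewrite lt_min ltr01 divr_gt0// mulr_gt0.
have [d2 d20 dP2] := exp_circ_littleo e20.
exists (Num.min d2 (d1 / (4 * (W + 1)))).
  by rewrite lt_min d20 divr_gt0// mulr_gt0.
move=> s' t'; rewrite !lt_min => /andP[x2 x1] /andP[y2 y1].
have {dP2} := dP2 _ _ x2 y2.
set x := s' - s in x1 x2 *; set y := t' - t in y1 y2 *.
set X := `|x| + `|y|; set v := x%:C + I * y%:C.
set r := _ - 1 - v => rP.
have X0 : 0 <= X by rewrite addr_ge0.
have r1 : normc r <= X.
  by apply: le_trans rP _; rewrite ler_piMl// ge_min lexx.
have r2 : normc c * W * normc r <= e / 2 * X.
  apply: (@le_trans _ _ (normc c * W * (e / (2 * (normc c * W + 1)) * X))).
    apply: ler_wpM2l => //; apply: le_trans rP _.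
    by rewrite ler_wpM2r// ge_min lexx orbT.
  rewrite mulrA ler_wpM2r// mulrCA ler_pM2l// ler_pdivrMr ?mulr_gt0//.
  by lra.
have vX : normc v <= X.
  apply: le_trans (le_normcD _ _) _; rewrite normcM !normc_real.
  by rewrite normcI mul1r.
have w'E : (expR s')%:C * circ_pt t' - w = w * (v + r).
  have -> : circ_pt t' = circ_pt t * circ_pt y.
    by rewrite -circ_ptD; congr circ_pt; rewrite /y; ring.
  have -> : expR s' = expR s * expR x.
    by rewrite -expRD; congr expR; rewrite /x; ring.
  by rewrite rmorphM /r /w; ring.
set w' := _ * circ_pt t' in w'E *.
have ww' : normc (w' - w) <= W * (2 * X).
  rewrite w'E normcM ler_wpM2l//; apply: le_trans (le_normcD _ _) _; lra.
have /dP1 fw : normc (w' - w) < d1.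
  apply: le_lt_trans ww' _.
  move: x1 y1; rewrite !ltr_pdivlMr ?mulr_gt0// => x1 y1.
  have : X * (4 * (W + 1)) < 2 * d1 by rewrite mulrDl; lra.
  have : 0 <= W * X by rewrite mulr_ge0.
  by lra.
have -> : f w' - f w - c * w * v = (f w' - f w - c * (w' - w)) + c * w * r.
  by rewrite w'E; ring.
apply: le_trans (le_normcD _ _) _; rewrite (normcM (c * w)) (normcM c) -/W.
suff : normc (f w' - f w - c * (w' - w)) <= e / 2 * X by lra.
apply: le_trans fw _.
apply: (@le_trans _ _ (e / (4 * (W + 1)) * (W * (2 * X)))).
  by rewrite ler_wpM2l// ltW.
rewrite !mulrA ler_wpM2r// -!mulrA ler_pM2l// mulrC ler_pdivrMr ?mulr_gt0//.
by lra.
Qed.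

Definition circle_mean n (f : C -> C) : C :=
  dyadic_mean n (fun t => f (circ_pt t)) 0 (2 * pi).

(** Goursat's lemma on [[ln r1, ln r2] x [0, 2 pi]]: the edges at angles 0 and [2 pi] cancel by
    periodicity, leaving [2 pi I] times the difference of the two means. *)
Lemma circle_mean_annulus (f : C -> C) (r1 r2 : R) : 0 < r1 < r2 ->
  (forall z, r1 <= normc z <= r2 -> derivable (f : C -> C^o) z 1) ->
  forall e : R, 0 < e -> \forall n \near \oo,
    normc (circle_mean n (fun z => f (r2%:C * z)) -
           circle_mean n (fun z => f (r1%:C * z))) <= e.
Proof.
move=> /andP[r10 r12] df e e0.
have r20 : 0 < r2 := lt_trans r10 r12.
pose H s t := f ((expR s)%:C * circ_pt t).
have a0 : 0 < ln r2 - ln r1 by rewrite subr_gt0 ltr_ln.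
have pi20 : 0 < 2 * pi :> R by rewrite mulr_gt0// pi_gt0.
have pie : 0 < 2 * pi * e by rewrite mulr_gt0.
apply: filterS (@Goursat_rectangle _ H (ln r1) 0 (ln r2 - ln r1) (2 * pi)
  a0 pi20 _ _ pie); last first.
  move=> s t sP _; apply: derivable_polar; apply: df.
  rewrite normcM normc_circ_pt mulr1 normc_real ger0_norm ?expR_ge0//.
  by apply/andP; split; rewrite -ler_ln ?posrE ?expR_gt0// expRK; lra.
move=> n; rewrite /circulation add0r.
rewrite (_ : H^~ (2 * pi) = H^~ 0); last first.
  by apply/funext => s; rewrite /H circ_pt2pi.
rewrite subrr mulr0 add0r subrKC normcM normcM normc_real.
rewrite normcI mul1r.
by rewrite gtr0_norm// ler_pM2l// /H !lnK.
Qed.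

End Polar.

(** * Cauchy's formula *)

Section Cauchy.
Context {R : realType}.
Local Notation C := (Cplx R).
Local Notation I := (0 +i* 1 : C).

Definition cont_at (f : C -> C) (z : C) := forall e : R, 0 < e ->
  exists2 d : R, 0 < d &
    forall w, normc (w - z) < d -> normc (f w - f z) <= e.

Lemma derivableZ_comp (f : C -> C) (z c : C) :
  derivable (f : C -> C^o) (c * z) 1 ->
  derivable ((fun w => f (c * w)) : C -> C^o) z 1.
Proof.
move=> df; apply/derivable1_diffP.
have h1 := (derivable1_diffP _ _).1 df.
have h2 := (derivable1_diffP _ _).1
  (@derivableM C C _ _ z 1 (derivable_cst c z 1) (@derivable_id _ C z 1)).
exact: (differentiable_comp h2 h1).
Qed.

Lemma derivable_subr_cst (p z : C) : derivable ((fun w => w - p) : C -> C^o) z 1.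
Proof.
have h := derivableB (@derivable_id _ C z 1) (derivable_cst (p : C) z 1).
exact: h.
Qed.

Lemma circle_meanD n (f g : C -> C) :
  circle_mean n (fun z => f z + g z) = circle_mean n f + circle_mean n g.
Proof. exact: dyadic_meanD. Qed.

Lemma circle_meanZ n (c : C) (f : C -> C) :
  circle_mean n (fun z => c * f z) = c * circle_mean n f.
Proof. by rewrite /circle_mean /dyadic_mean -mulr_sumr mulrCA. Qed.

Lemma circle_meanB n (f g : C -> C) :
  circle_mean n f - circle_mean n g = circle_mean n (fun z => f z - g z).
Proof. by rewrite /circle_mean /dyadic_mean -mulrBr -sumrB. Qed.

Lemma circle_mean_cst n (c : C) : circle_mean n (fun=> c) = c.
Proof. exact: dyadic_mean_cst. Qed.

Lemma eq_circle_mean n (f g : C -> C) :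
  (forall z, z * z^* = 1 -> f z = g z) -> circle_mean n f = circle_mean n g.
Proof.
move=> fg; apply: eq_dyadic_mean => t; apply: fg.
by rewrite -normcCK normc_circ_pt expr1n.
Qed.

Lemma normc_circle_meanB n (f g : C -> C) (e : R) :
  (forall t, 0 <= t <= 2 * pi -> normc (f (circ_pt t) - g (circ_pt t)) <= e) ->
  normc (circle_mean n f - circle_mean n g) <= e.
Proof.
move=> fge; rewrite circle_meanB; apply: normc_dyadic_mean.
  by rewrite mulr_ge0// pi_ge0.
by move=> t; rewrite add0r; exact: fge.
Qed.

(** The mean over the unit circle is asymptotically the mean over a small circle, where continuity
    makes [f] close to [f 0]. *)
Lemma circle_mean_center (f : C -> C) :
  (forall z, 0 < normc z <= 1 -> derivable (f : C -> C^o) z 1) ->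
  cont_at f 0 ->
  circle_mean n f @[n --> \oo] --> f 0.
Proof.
move=> df f0; apply/normc_cvgP => e e0.
have e20 : 0 < e / 2 by rewrite divr_gt0.
have [d d0 dP] := f0 _ e20; pose r := Num.min 2^-1 (d / 2).
have r0 : 0 < r by rewrite lt_min invr_gt0 ltr0n/= divr_gt0.
have r1 : r < 1 by rewrite gt_min invf_lt1 ?ltr1n.
have r01 : 0 < r < 1 by rewrite r0.
have [z /andP[rz z1]|N _ NP] := @circle_mean_annulus _ f r 1 r01 _ _ e20.
  by apply: df; rewrite (lt_le_trans r0).
exists N => // n /NP /= h.
have hr : normc (circle_mean n (fun z => f (r%:C * z)) - f 0) <= e / 2.
  rewrite -[f 0](circle_mean_cst n); apply: normc_circle_meanB => t _.
  apply: dP; rewrite subr0 normcM normc_circ_pt mulr1 normc_real gtr0_norm//.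
  by rewrite gt_min; apply/orP; right; lra.
have E : circle_mean n (fun z => f (1%:C * z)) = circle_mean n f.
  by apply: eq_circle_mean => z _; rewrite rmorph1 mul1r.
rewrite E in h; rewrite -[_ - _](subrKA (circle_mean n (fun z => f (r%:C * z)))).
by apply: le_trans (le_normcD _ _) _; lra.
Qed.

Lemma circle_unif_cont (f : C -> C) (rho : R) : 0 < rho ->
  (forall z, normc z = rho -> cont_at f z) ->
  forall e : R, 0 < e -> exists2 d : R, 0 < d & forall r, `|r - rho| < d ->
    forall t, 0 <= t <= 2 * pi ->
      normc (f (r%:C * circ_pt t) - f (rho%:C * circ_pt t)) <= e.
Proof.
move=> rho0 fc e e0.
(* [P] ignores its first interval: the bisection in the plane is used for the angle only. *)
pose P (x y a b : R) := exists2 d : R, 0 < d & forall r, `|r - rho| < d ->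
  forall t, y <= t <= y + b ->
    normc (f (r%:C * circ_pt t) - f (rho%:C * circ_pt t)) <= e.
have pi20 : 0 < 2 * pi :> R by rewrite mulr_gt0// pi_gt0.
suff [d d0 dP] : P 0 0 1 (2 * pi).
  by exists d => // r rd t tP; apply: dP => //; rewrite add0r.
apply: (@rectangle_bisection _ P) => // [x y a b a0 b0 [d1 d10 P1] _|s t _ _].
  move=> [d2 d20 P2] _; exists (Num.min d1 d2); first by rewrite lt_min d10.
  move=> r; rewrite lt_min => /andP[/P1 r1 /P2 r2] t /andP[yt tb].
  have [tb2|tb2] := leP t (y + b / 2); first by apply: r1; rewrite yt.
  by apply: r2; apply/andP; split; lra.
have e20 : 0 < e / 2 by rewrite divr_gt0.
have nz : normc (rho%:C * circ_pt t) = rho.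
  by rewrite normcM normc_circ_pt mulr1 normc_real gtr0_norm.
have [d d0 dP] := fc _ nz _ e20.
have [d2 d20 d2P] := exp_circ_littleo (ltr01 : 0 < 1 :> R).
exists (Num.min d2 (d / (4 * rho))).
  by rewrite lt_min d20 divr_gt0// mulr_gt0.
move=> x y a b a0 b0; rewrite lt_min => /andP[ab1 ab2] _ yt _ _ _ _.
have key r t' : `|r - rho| < d / 2 -> y <= t' <= y + b ->
    normc (f (r%:C * circ_pt t') - f (rho%:C * circ_pt t)) <= e / 2.
  move=> rd yt'; apply: dP.
  have tt' : `|t' - t| <= b by rewrite ler_norml; lra.
  have := d2P 0 (t' - t); rewrite normr0 => /(_ d20) h.
  have {}h : normc (circ_pt (t' - t) - 1) <= 2 * `|t' - t|.
    have {h} := h (le_lt_trans tt' (lt_trans _ ab1)).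
    rewrite expR0 rmorph1 !mul1r !add0r => h.
    rewrite -[_ - 1](subrK (I * (t' - t)%:C)).
    apply: le_trans (le_normcD _ _) _; rewrite normcM normc_real.
    rewrite normcI mul1r.
    by have := h _; rewrite ltrDr => /(_ a0); lra.
  have -> : r%:C * circ_pt t' - rho%:C * circ_pt t = (r - rho)%:C * circ_pt t' +
      rho%:C * circ_pt t * (circ_pt (t' - t) - 1).
    have -> : circ_pt t' = circ_pt t * circ_pt (t' - t).
      by rewrite -circ_ptD addrC subrK.
    by rewrite rmorphB; ring.
  apply: le_lt_trans (le_normcD _ _) _.
  rewrite !normcM !normc_circ_pt !normc_real !mulr1 (gtr0_norm rho0)//.
  have h3 : rho * normc (circ_pt (t' - t) - 1) <= rho * (2 * b).
    by rewrite ler_pM2l//; lra.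
  have h4 : (a + b) * (4 * rho) < d by rewrite -ltr_pdivlMr// mulr_gt0.
  have h5 : 0 < a * rho by rewrite mulr_gt0.
  by rewrite mulrDl in h4; lra.
exists (d / 2); first by rewrite divr_gt0.
move=> r rd t' yt'.
have k1 := key _ _ rd yt'.
have k2 : normc (f (rho%:C * circ_pt t') - f (rho%:C * circ_pt t)) <= e / 2.
  by apply: key => //; rewrite subrr normr0 divr_gt0.
rewrite -[_ - _](subrKA (f (rho%:C * circ_pt t))).
by apply: le_trans (le_normcD _ _) _; rewrite [X in _ + X]normcB; lra.
Qed.

(* The circle through the exceptional point [p] is crossed by uniform
   continuity: the means of [f] over the circles just inside and just outside
   of it are close. *)
Lemma circle_mean_center_except (f : C -> C) (p : C) : 0 < normc p < 1 ->
  (forall z, normc z <= 1 -> z != p -> derivable (f : C -> C^o) z 1) ->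
  cont_at f p ->
  circle_mean n f @[n --> \oo] --> f 0.
Proof.
move=> /andP[p0 p1] df fp; apply/normc_cvgP => e e0.
have e40 : 0 < e / 4 by rewrite divr_gt0.
have fcont z : normc z <= 1 -> cont_at f z.
  by move=> z1; have [->//|zp] := eqVneq z p; apply: derivable_cont; exact: df.
have [|d d0 dP] := @circle_unif_cont f (normc p) p0 _ _ e40.
  by move=> z zp; apply: fcont; rewrite zp ltW.
(* Radii on both sides of [normc p] and within [d] of it; the max and the min keep them inside
   [(0, 1)] when [d] is large. *)
pose r1 := Num.max (normc p / 2) (normc p - d / 2).
pose r2 := Num.min ((1 + normc p) / 2) (normc p + d / 2).
have [r1p r10 r1d] : [/\ r1 < normc p, 0 < r1 & `|r1 - normc p| < d].
  have r1p : r1 < normc p by rewrite gt_max; lra.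
  have r1d : normc p - d / 2 <= r1 by rewrite le_max lexx orbT.
  split=> //; first by rewrite lt_max divr_gt0.
  by rewrite ltr_norml; lra.
have [r2p r21 r2d] : [/\ normc p < r2, r2 < 1 & `|r2 - normc p| < d].
  have r2p : normc p < r2 by rewrite lt_min; lra.
  have r2d : r2 <= normc p + d / 2 by rewrite ge_min lexx orbT.
  split=> //; first by rewrite gt_min; apply/orP; left; lra.
  by rewrite ltr_norml; lra.
have in1 z : normc z <= 1 -> normc (r1%:C * z) < normc p.
  move=> z1; rewrite normcM normc_real gtr0_norm//.
  by apply: le_lt_trans r1p; rewrite ler_piMr// ltW.
have c1 : circle_mean n (fun z => f (r1%:C * z)) @[n --> \oo] --> f (r1%:C * 0).
  apply: (@circle_mean_center (fun z => f (r1%:C * z))).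
    move=> z /andP[_ /in1 z1]; apply: derivableZ_comp; apply: df.
      by rewrite ltW// (lt_trans z1).
    by apply: contraTneq z1 => ->; rewrite ltxx.
  apply: derivable_cont; apply: derivableZ_comp; apply: df; rewrite mulr0 ?normc0//.
  by apply: contraTneq p0 => <-; rewrite normc0 ltxx.
move/normc_cvgP/(_ _ e40) : c1; rewrite mulr0 => c1.
have r201 : 0 < r2 < 1 by rewrite (lt_trans p0 r2p).
have c2 : \forall n \near \oo, normc (circle_mean n (fun z => f (1%:C * z)) -
    circle_mean n (fun z => f (r2%:C * z))) <= e / 4.
  apply: circle_mean_annulus => // z /andP[rz z1]; apply: df => //.
  by apply: contraTneq rz => ->; rewrite -ltNge.
near=> n.
have h1 : normc (circle_mean n (fun z => f (r1%:C * z)) - f 0) <= e / 4.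
  by near: n.
have h2 : normc (circle_mean n (fun z => f (1%:C * z)) -
    circle_mean n (fun z => f (r2%:C * z))) <= e / 4.
  by near: n.
have h3 := @normc_circle_meanB n (fun z => f (r1%:C * z))
  (fun z => f ((normc p)%:C * z)) _ (dP _ r1d).
have h4 := @normc_circle_meanB n (fun z => f (r2%:C * z))
  (fun z => f ((normc p)%:C * z)) _ (dP _ r2d).
have E : circle_mean n (fun z => f (1%:C * z)) = circle_mean n f.
  by apply: eq_circle_mean => z _; rewrite rmorph1 mul1r.
rewrite E in h2.
rewrite -[_ - _](subrKA (circle_mean n (fun z => f (r2%:C * z)))).
apply: le_trans (le_normcD _ _) _.
have := le_normcD (circle_mean n (fun z => f (r2%:C * z)) -
  circle_mean n (fun z => f ((normc p)%:C * z)))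
  (circle_mean n (fun z => f ((normc p)%:C * z)) - f 0).
rewrite subrKA => h5.
have := le_normcD (circle_mean n (fun z => f ((normc p)%:C * z)) -
  circle_mean n (fun z => f (r1%:C * z)))
  (circle_mean n (fun z => f (r1%:C * z)) - f 0).
rewrite subrKA normcB => h6.
lra.
Unshelve. all: by end_near. Qed.

Lemma circle_mean_conj n (f : C -> C) :
  circle_mean n (fun z => (f z)^*) = (circle_mean n f)^*.
Proof.
by rewrite /circle_mean /dyadic_mean rmorphM rmorph_sum fmorphV rmorphXn rmorph_nat.
Qed.

Lemma normc_conj (z : C) : normc z^* = normc z.
Proof. by apply: complexI; exact: (norm_conjC z). Qed.

Lemma cvg_conj (u : nat -> C) (l : C) :
  u n @[n --> \oo] --> l -> (u n)^* @[n --> \oo] --> l^*.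
Proof.
move=> /normc_cvgP ul; apply/normc_cvgP => e /ul; apply: filterS => n.
by rewrite -normc_conj rmorphB /=.
Qed.

Lemma szego_neq0 (p z : C) : normc p < 1 -> normc z <= 1 -> 1 - p * z != 0.
Proof.
move=> p1 z1; rewrite subr_eq0; apply/eqP => e.
have : normc (p * z) < 1.
  by rewrite normcM; apply: le_lt_trans p1; rewrite ler_piMr// normc_ge0.
by rewrite -e normc1 ltxx.
Qed.

Lemma derivable_szego (p z : C) : normc p < 1 -> normc z <= 1 ->
  derivable ((fun w => (1 - p * w)^-1) : C -> C^o) z 1.
Proof.
move=> p1 z1.
have h1 := @derivableM C C _ _ z 1 (derivable_cst p z 1) (@derivable_id _ C z 1).
have h2 : derivable ((fun w => 1 - p * w) : C -> C^o) z 1.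
  exact: (derivableB (derivable_cst (1 : C) z 1) h1).
exact: (@derivableV C C (fun w => 1 - p * w) z 1 (szego_neq0 p1 z1) h2).
Qed.

Lemma derivable_slope (f : C -> C) (p z : C) :
  derivable (f : C -> C^o) z 1 -> z != p ->
  derivable ((fun w => w * ((f w - f p) * (w - p)^-1)) : C -> C^o) z 1.
Proof.
move=> df zp; have zp0 : z - p != 0 by rewrite subr_eq0.
have h1 := @derivableV C C (fun w => w - p) z 1 zp0 (@derivable_subr_cst p z).
have h2 := derivableB df (derivable_cst (f p) z 1).
exact: (derivableM (@derivable_id _ C z 1) (derivableM h2 h1)).
Qed.

(** On the circle [z^* = 1 / z], so the integrand is [z (f z - f p) / (z - p) + f p / (1 - p z^* )].
    The first term, completed at [p] by [p f'(p)], is continuous there and vanishes at 0; the mean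
    of [1 / (1 - p z^* )] is the conjugate of that of a holomorphic function with value 1 at 0. *)
Lemma Cauchy_circle (f : C -> C) (p : C) : normc p < 1 ->
  (forall z, normc z <= 1 -> derivable (f : C -> C^o) z 1) ->
  circle_mean n (fun z => f z * (1 - p * z^*)^-1) @[n --> \oo] --> f p.
Proof.
(* The exceptional point must differ from the center; for [p = 0] the kernel is 1 and the mean value
   property suffices. *)
move=> p1 df; have [->|p0] := eqVneq p 0.
  rewrite (_ : (fun n => _) = circle_mean^~ f); last first.
    by apply/funext => n; apply: eq_circle_mean => z _; rewrite mul0r subr0 invr1 mulr1.
  apply: circle_mean_center => [z /andP[_]|]; first exact: df.
  by apply: derivable_cont; apply: df; rewrite normc0.
have [c cP] := derivable_littleo (df _ (ltW p1)).
pose psi z := if z == p then p * c else z * ((f z - f p) * (z - p)^-1).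
have psi0 : circle_mean n psi @[n --> \oo] --> psi 0.
  have p01 : 0 < normc p < 1.
    by rewrite p1 andbT lt_neqAle normc_ge0 andbT eq_sym; apply: contra p0 => /eqP/eq0_normc ->.
  apply: (circle_mean_center_except p01) => [z z1 zp|e e0].
    have dpsi := derivable_slope (df z z1) zp.
    apply: near_eq_derivable dpsi.
    have zp0 : 0 < `|z - p| by rewrite normr_gt0 subr_eq0.
    apply: filterS (nbhsx_ballx (z : C) _ zp0) => w.
    rewrite -ball_normE /= => zw; rewrite /psi; case: eqP zw => // ->.
    by rewrite ltxx.
  have c0 : 0 <= normc c := normc_ge0 c.
  have p0' : 0 <= normc p := normc_ge0 p.
  have e20 : 0 < e / 4 by rewrite divr_gt0.
  have [d d0 dP] := cP _ e20.
  exists (Num.min d (Num.min 1 (e / (2 * (normc c + 1))))).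
    by rewrite !lt_min d0 ltr01 divr_gt0// mulr_gt0// ltr_wpDl.
  move=> w; rewrite !lt_min => /and3P[/dP wd w1 w2].
  rewrite /psi eqxx; case: eqP => [_|/eqP wp]; first by rewrite subrr normc0 ltW.
  have wp0 : w - p != 0 by rewrite subr_eq0.
  have nwp0 : 0 < normc (w - p).
    rewrite lt_neqAle normc_ge0 andbT eq_sym.
    by apply: contra wp0 => /eqP/eq0_normc ->.
  have -> : w * ((f w - f p) / (w - p)) - p * c =
      w * ((f w - f p - c * (w - p)) * (w - p)^-1) + (w - p) * c by field.
  have h1 : normc ((f w - f p - c * (w - p)) * (w - p)^-1) <= e / 4.
    by rewrite normcM normcV ler_pdivrMr.
  have h2 : normc w <= 2.
    by rewrite -[w](subrK p); apply: le_trans (le_normcD _ _) _; lra.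
  have h3 : normc w * normc ((f w - f p - c * (w - p)) * (w - p)^-1) <= 2 * (e / 4).
    by apply: ler_pM => //; exact: normc_ge0.
  apply: le_trans (le_normcD _ _) _; rewrite normcM (normcM (w - p)).
  move: w2; rewrite ltr_pdivlMr ?mulr_gt0// ?ltr_wpDl// => w2.
  by lra.
have kappa : circle_mean n (fun z => (1 - p^* * z)^-1) @[n --> \oo] --> (1 : C).
  have pc1 : normc p^* < 1 by rewrite normc_conj.
  have {2}-> : 1 = (1 - p^* * 0)^-1 by rewrite mulr0 subr0 invr1.
  apply: (@circle_mean_center (fun z => (1 - p^* * z)^-1)).
    by move=> z /andP[_]; exact: derivable_szego.
  by apply: derivable_cont; apply: derivable_szego; rewrite ?normc0.
have lim : circle_mean n psi + f p * (circle_mean n (fun z => (1 - p^* * z)^-1))^*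
    @[n --> \oo] --> psi 0 + f p * 1^*.
  exact: (cvgD psi0 (cvg_mull (c := f p) (cvg_conj kappa))).
move: lim; rewrite {2}/psi eq_sym (negbTE p0) mul0r add0r rmorph1 mulr1.
move=> /eq_cvgn; apply=> n.
rewrite -circle_mean_conj -circle_meanZ -circle_meanD; apply: eq_circle_mean => z zz.
have z0 : z != 0 by apply/eqP => z0; move: zz; rewrite z0 mul0r => /eqP; rewrite eq_sym oner_eq0.
have nz := normc_unit zz.
have -> : psi z = z * ((f z - f p) * (z - p)^-1).
  rewrite /psi; case: eqP => // e; move: p1; rewrite -e nz ltxx //.
have zp : z - p != 0.
  by rewrite subr_eq0; apply/eqP => e; move: p1; rewrite -e nz ltxx.
have -> : ((1 - p^* * z)^-1)^* = (1 - p * z^*)^-1.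
  by rewrite fmorphV rmorphB rmorph1 rmorphM /= conjCK.
have -> : z^* = z^-1 by apply: (mulfI z0); rewrite zz divff.
by field; rewrite z0 zp.
Qed.

End Cauchy.

(** * Pick's theorem *)

Section Pick.
Context {R : realType}.
Local Notation C := (Cplx R).
Local Notation D := (unit_disk R).

Lemma unit_diskP (z : C) : D z <-> normc z < 1.
Proof. by split; rewrite /unit_disk /= -ltcR. Qed.

Definition szego (x y : C) : C := (1 - x * y^*)^-1.

Lemma psd_circle_mean (T : eqType) (A : set T) (k : C -> T -> T -> C) n :
  (forall z, z * z^* = 1 -> psd A (k z)) ->
  psd A (fun x y => circle_mean n (fun z => k z x y)).
Proof.
move=> kA; apply: psdZ; first by rewrite invr_ge0 exprn_ge0.
apply: psd_sum => j; apply: kA.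
by rewrite -normcCK normc_circ_pt expr1n.
Qed.

Lemma szego_conj (x z : C) : ((1 - x^* * z)^-1)^* = (1 - x * z^*)^-1.
Proof. by rewrite fmorphV rmorphB rmorph1 rmorphM /= conjCK. Qed.

(** Cauchy's formula at [x] for [f z / (1 - y^* z)]. The two outer factors of the integrand form a
    rank one kernel in [(x, y)]. *)
Lemma Cauchy_szego (f : C -> C) (x y : C) : D x -> D y ->
  (forall z, normc z <= 1 -> derivable (f : C -> C^o) z 1) ->
  circle_mean n (fun z => (1 - x * z^*)^-1 * f z * (1 - y^* * z)^-1)
    @[n --> \oo] --> f x * szego x y.
Proof.
move=> /unit_diskP x1 /unit_diskP y1 df; rewrite /szego [x * _]mulrC.
have dfk z : normc z <= 1 ->
    derivable ((fun w => f w * (1 - y^* * w)^-1) : C -> C^o) z 1.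
  move=> z1; have yc1 : normc y^* < 1 by rewrite normc_conj.
  exact: (derivableM (df _ z1) (derivable_szego yc1 z1)).
apply: (eq_cvgn (Cauchy_circle x1 dfk)) => n.
by apply: eq_circle_mean => z _; ring.
Qed.

(** An instance of the Schur product theorem: the Szego kernel is a limit of averages of rank one
    kernels, and a product with a rank one kernel stays nonnegative. *)
Lemma psd_mul_szego (T : eqType) (A : set T) (k : T -> T -> C) (u : T -> C) :
  (forall x, A x -> D (u x)) -> psd A k ->
  psd A (fun x y => k x y * szego (u x) (u y)).
Proof.
move=> uD kA; pose kn n x y := circle_mean n (fun z =>
  (1 - u x * z^*)^-1 * k x y * ((1 - u y * z^*)^-1)^*).
apply: (psd_cvg (k := kn)) => [n|x y Ax Ay].
  by apply: psd_circle_mean => z _; exact: psd_mulr1.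
have h := @Cauchy_szego (fun=> k x y) _ _ (uD _ Ax) (uD _ Ay)
  (fun z _ => derivable_cst _ _ _).
apply: (eq_cvgn h) => n; apply: eq_circle_mean => z _.
by rewrite -(szego_conj (u y)) conjCK.
Qed.

Lemma psd_szego : psd D szego.
Proof.
apply: eq_psd (psd_mul_szego (u := id) (fun _ => id) (psd_rank1 (fun=> 1))).
by move=> x y _ _; rewrite rmorph1 mulr1 mul1r.
Qed.

(* Integrating over the circle against Cauchy kernels turns
   (B^2 - |f(z)|^2) + (f(z) - f(x)) (f(z) - f(y))^* into
   (B^2 - f(x) f(y)^* ) / (1 - x y^* ). *)
Lemma Pick_closed_disk (f : C -> C) (B : R) :
  (forall z, normc z <= 1 -> derivable (f : C -> C^o) z 1) ->
  (forall z, normc z <= 1 -> normc (f z) <= B) ->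
  psd D (fun x y => (B%:C ^+ 2 - f x * (f y)^*) * szego x y).
Proof.
move=> df fB.
pose kn n x y := circle_mean n (fun z => (1 - x * z^*)^-1 *
  ((B%:C ^+ 2 - `|f z| ^+ 2) + (f x - f z) * (f y - f z)^*) *
  ((1 - y * z^*)^-1)^*).
have df1 z : normc z <= 1 -> derivable ((fun=> 1) : C -> C^o) z 1.
  by move=> _; exact: derivable_cst.
apply: (psd_cvg (k := kn)) => [n|x y xD yD].
  apply: psd_circle_mean => z zz; apply: psd_mulr1; apply: psdD; last first.
    exact: (psd_rank1 (fun x => f x - f z)).
  have c0 : 0 <= B%:C ^+ 2 - `|f z| ^+ 2 :> C.
    have z1 : normc z <= 1 by rewrite normc_unit.
    have B0 : 0 <= B := le_trans (normc_ge0 _) (fB _ z1).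
    rewrite subr_ge0 lerXn2r ?nnegrE ?normr_ge0 ?ler0c//.
    by rewrite -[`|f z|]/((normc (f z))%:C) lecR fB.
  apply: eq_psd (psdZ c0 (psd_rank1 (fun=> 1))) => x y _ _.
  by rewrite rmorph1 !mulr1.
pose S n (g : C -> C) (p q : C) : C := circle_mean n
  (fun z => (1 - p * z^*)^-1 * g z * (1 - q^* * z)^-1).
have lim : (B%:C ^+ 2 + f x * (f y)^*) * S n (fun=> 1) x y +
      - (f y)^* * S n f x y + - f x * (S n f y x)^* @[n --> \oo] -->
    ((B%:C ^+ 2 + f x * (f y)^*) * (1 * szego x y) +
      - (f y)^* * (f x * szego x y) + - f x * (f y * szego y x)^* : C).
  exact: (cvgD (cvgD (cvg_mull (Cauchy_szego xD yD df1))
    (cvg_mull (Cauchy_szego xD yD df))) (cvg_mull (cvg_conj (Cauchy_szego yD xD df)))).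
move: lim.
have -> : (B%:C ^+ 2 + f x * (f y)^*) * (1 * szego x y) +
    - (f y)^* * (f x * szego x y) + - f x * (f y * szego y x)^* =
    (B%:C ^+ 2 - f x * (f y)^*) * szego x y.
  rewrite rmorphM /= /szego.
  have -> : ((1 - y * x^*)^-1)^* = (1 - x * y^*)^-1 :> C.
    by rewrite -szego_conj conjCK mulrC.
  ring.
move=> /eq_cvgn; apply => n.
rewrite /S -circle_mean_conj -!circle_meanZ -!circle_meanD.
apply: eq_circle_mean => z _.
rewrite -!szego_conj normCK !rmorphM !rmorphB /= !conjCK.
ring.
Qed.

(** The dilates of [f] by [1 - 1 / (n + 1)] are differentiable on the closed disk, keep the bound
    [B] and converge pointwise to [f]. *)
Lemma Pick_disk (f : C -> C) (B : R) :
  (forall z, D z -> derivable (f : C -> C^o) z 1) ->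
  (forall z, D z -> normc (f z) <= B) ->
  psd D (fun x y => (B%:C ^+ 2 - f x * (f y)^*) * szego x y).
Proof.
move=> df fB; pose r n : R := 1 - harmonic n.
have r01 n : 0 <= r n < 1.
  rewrite subr_ge0 gtrBl harmonic_gt0 andbT.
  by rewrite /harmonic /= invf_le1 ?ler1n ?ltr0n.
have rD n z : normc z <= 1 -> D ((r n)%:C * z).
  move=> z1; apply/unit_diskP; rewrite normcM normc_real.
  have /andP[r0 r1] := r01 n; rewrite ger0_norm//.
  by apply: le_lt_trans r1; rewrite ler_piMr.
have fr (x : C) : D x -> f ((r n)%:C * x) @[n --> \oo] --> f x.
  move=> xD; apply/normc_cvgP => e e0.
  have [d d0 dP] := derivable_cont (df _ xD) e0.
  have /cvgrPdist_lt/(_ _ d0) : harmonic @ \oo --> (0 : R) := @cvg_harmonic R.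
  apply: filterS => n; rewrite sub0r normrN ger0_norm ?harmonic_ge0// => hd.
  apply: dP; rewrite [X in normc X](_ : _ = - (harmonic n)%:C * x); last first.
    by rewrite rmorphB rmorph1; ring.
  rewrite normcM normcN normc_real ger0_norm ?harmonic_ge0//.
  apply: le_lt_trans hd; rewrite ler_piMr ?harmonic_ge0// ltW//.
  exact/unit_diskP.
apply: (psd_cvg (k := fun n x y =>
  (B%:C ^+ 2 - f ((r n)%:C * x) * (f ((r n)%:C * y))^*) * szego x y)) => [n|x y xD yD].
  apply: (@Pick_closed_disk (fun z => f ((r n)%:C * z))) => z z1.
    by apply: derivableZ_comp; apply: df; exact: rD.
  by apply: fB; exact: rD.
apply: cvg_mulr; apply: cvgB; first exact: cvg_cst.
by apply: cvgM; [exact: fr|apply: cvg_conj; exact: fr].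
Qed.

End Pick.

(** * Blaschke products *)

Section Blaschke.
Context {R : realType}.
Local Notation C := (Cplx R).
Local Notation D := (unit_disk R).

Lemma unit_disk_conj (z : C) : D z -> D z^*.
Proof. by move=> /unit_diskP z1; apply/unit_diskP; rewrite normc_conj. Qed.

Lemma szegoV_neq0 (x y : C) : D x -> D y -> 1 - x * y^* != 0.
Proof.
move=> /unit_diskP x1 /unit_diskP y1.
by apply: szego_neq0 => //; rewrite normc_conj ltW.
Qed.

Lemma szegoV_neq0' (x y : C) : D x -> D y -> 1 - x^* * y != 0.
Proof.
by move=> xD yD; have := szegoV_neq0 (unit_disk_conj xD) (unit_disk_conj yD);
  rewrite conjCK.
Qed.

Definition mobius (a z : C) : C := (z - a) * (1 - a^* * z)^-1.

Lemma mobius_kernel (a x y : C) : D a -> D x -> D y ->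
  1 - mobius a x * (mobius a y)^* =
  (1 - a * a^*) * ((1 - a^* * x)^-1 * (1 - x * y^*) * ((1 - a^* * y)^-1)^*).
Proof.
move=> aD xD yD; rewrite /mobius rmorphM rmorphB /= szego_conj.
by field; rewrite szegoV_neq0'//= szegoV_neq0.
Qed.

Lemma mobius_kernel_szego (a x y : C) : D a -> D x -> D y ->
  (1 - mobius a x * (mobius a y)^*) * szego x y =
  (1 - a * a^*) * ((1 - a^* * x)^-1 * ((1 - a^* * y)^-1)^*).
Proof.
move=> aD xD yD; rewrite mobius_kernel// szego_conj /szego.
by field; rewrite szegoV_neq0'//= !szegoV_neq0.
Qed.

Lemma disk_ge0 (a : C) : D a -> 0 <= 1 - a * a^*.
Proof.
move=> aD; rewrite -normCK subr_ge0 expr_le1 ?normr_ge0//; exact: ltW.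
Qed.

Lemma mobius_disk (a z : C) : D a -> D z -> D (mobius a z).
Proof.
move=> aD zD; rewrite /unit_disk /= -(@expr_lt1 _ 2) ?normr_ge0//.
rewrite normCK -subr_gt0 mobius_kernel//.
have pos (u : C) : D u -> 0 < 1 - u * u^*.
  by move=> uD; rewrite -normCK subr_gt0 expr_lt1 ?normr_ge0.
rewrite mulrAC -(normCK (1 - a^* * z)^-1) !mulr_gt0 ?pos//;
  by rewrite normr_gt0 invr_eq0 szegoV_neq0'.
Qed.

Lemma derivable_mobius (a z : C) : D a -> D z ->
  derivable (mobius a : C -> C^o) z 1.
Proof.
move=> /unit_disk_conj/unit_diskP a1 /unit_diskP/ltW z1.
exact: (derivableM (@derivable_subr_cst _ a z) (derivable_szego a1 z1)).
Qed.

Lemma psd_mobius (a : C) : D a ->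
  psd D (fun x y => (1 - mobius a x * (mobius a y)^*) * szego x y).
Proof.
move=> aD; apply: eq_psd (psdZ (disk_ge0 aD) (psd_rank1 _)) => x y xD yD.
by rewrite mobius_kernel_szego.
Qed.

(** Division-free bound on [szego z z / szego (f z) (f z)], the quotient that controls [|G z|^2] on
    the diagonal. *)
Definition defect_le (K : R) (f : C -> C) := forall z, D z ->
  1 - normc (f z) ^+ 2 <= K * (1 - normc z ^+ 2).

Lemma defect_complex (z : C) : (1 - normc z ^+ 2)%:C = 1 - z * z^*.
Proof. by rewrite -normcCK; exact: rmorphB. Qed.

(** The defect is [(1 - |a|^2) (1 - |z|^2) / |1 - a^* z|^2], and the denominator is at least
    [(1 - |a|)^2]. *)
Lemma mobius_defect (a : C) : D a -> exists2 K, 0 <= K & defect_le K (mobius a).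
Proof.
move=> aD; have a1 : 0 < 1 - normc a by rewrite subr_gt0; exact/unit_diskP.
have a2 : 0 <= 1 - normc a ^+ 2.
  by rewrite subr_ge0 expr_le1 ?normc_ge0//; lra.
exists ((1 - normc a ^+ 2) * (1 - normc a) ^- 2).
  by rewrite mulr_ge0// invr_ge0 exprn_ge0// ltW.
move=> z zD; have z1 : 0 <= 1 - normc z ^+ 2.
  by rewrite subr_ge0 expr_le1 ?normc_ge0// ltW//; exact/unit_diskP.
have -> : 1 - normc (mobius a z) ^+ 2 =
    (1 - normc a ^+ 2) * (1 - normc z ^+ 2) * (normc (1 - a^* * z)) ^- 2.
  have cM (u v : R) : (u * v)%:C = u%:C * v%:C :> C := rmorphM _ u v.
  have cV (u : R) : (u^-1)%:C = u%:C^-1 :> C := fmorphV _ u.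
  apply: complexI; rewrite !cM cV !defect_complex normcCK mobius_kernel//.
  rewrite rmorphB rmorph1 rmorphM /= conjCK szego_conj.
  by field; rewrite szegoV_neq0'//= szegoV_neq0.
rewrite [leRHS]mulrAC ler_wpM2l ?mulr_ge0// lef_pV2 ?posrE ?exprn_gt0//; last first.
  rewrite lt_neqAle normc_ge0 andbT eq_sym.
  by apply: contra (szegoV_neq0' aD zD) => /eqP/eq0_normc ->.
rewrite lerXn2r ?nnegrE ?normc_ge0 ?(ltW a1)//.
have := le_normcD (1 - a^* * z) (a^* * z); rewrite subrK normc1 normcM normc_conj.
have : normc a * normc z <= normc a.
  by rewrite ler_piMr ?normc_ge0// ltW//; exact/unit_diskP.
by lra.
Qed.

Definition blaschke (l : seq C) (z : C) : C := \prod_(a <- l) mobius a z.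

Lemma derivable_blaschke (l : seq C) (z : C) : {in l, forall a, D a} -> D z ->
  derivable (blaschke l : C -> C^o) z 1.
Proof.
move=> + zD; elim: l => [|a l IHl] lD.
  rewrite (_ : blaschke [::] = fun=> 1); last by apply/funext => w; rewrite /blaschke big_nil.
  exact: derivable_cst.
rewrite (_ : blaschke (a :: l) = fun w => mobius a w * blaschke l w); last first.
  by apply/funext => w; rewrite /blaschke big_cons.
have aD : D a by apply: lD; rewrite mem_head.
have {}IHl : derivable (blaschke l : C -> C^o) z 1.
  by apply: IHl => b bl; apply: lD; rewrite in_cons bl orbT.
exact: (derivableM (derivable_mobius aD zD) IHl).
Qed.

Lemma blaschke_le1 (l : seq C) (z : C) : {in l, forall a, D a} -> D z ->
  normc (blaschke l z) <= 1.
Proof.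
move=> + zD; elim: l => [|a l IHl] lD; first by rewrite /blaschke big_nil normc1.
rewrite /blaschke big_cons normcM mulr_ile1 ?normc_ge0//.
  by apply/ltW/unit_diskP/mobius_disk => //; apply: lD; rewrite mem_head.
by apply: IHl => b bl; apply: lD; rewrite in_cons bl orbT.
Qed.

(** Telescoping: for a factor [m] and the remaining product [B], [1 - m B (m B)^*] is
    [(1 - m m^* ) + m (1 - B B^* ) m^*]. *)
Lemma psd_blaschke (l : seq C) : {in l, forall a, D a} ->
  psd D (fun x y => (1 - blaschke l x * (blaschke l y)^*) * szego x y).
Proof.
elim: l => [|a l IHl] lD.
  apply: eq_psd (psdZ (lexx 0) psd_szego) => x y _ _.
  by rewrite /blaschke !big_nil rmorph1 mulr1 subrr.
have aD : D a by apply: lD; rewrite mem_head.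
have {}IHl := IHl (fun b bl => lD b (mem_behead (s := a :: l) bl)).
apply: eq_psd (psdD (psd_mobius aD) (psd_mulr1 (mobius a) IHl)) => x y _ _.
by rewrite /blaschke !big_cons [(mobius a y * _)^*]rmorphM /=; ring.
Qed.

(** The same telescoping on squared moduli, [1 - u v = (1 - u) + u (1 - v)]; the constants of the
    factors add up. *)
Lemma blaschke_defect (l : seq C) : {in l, forall a, D a} ->
  exists2 K, 0 <= K & defect_le K (blaschke l).
Proof.
elim: l => [|a l IHl] lD.
  exists 0 => // z _; rewrite /blaschke big_nil normc1; lra.
have aD : D a by apply: lD; rewrite mem_head.
have [K K0 KP] := IHl (fun b bl => lD b (mem_behead (s := a :: l) bl)).
have [L L0 LP] := mobius_defect aD.
exists (L + K) => [|z zD]; first by rewrite addr_ge0.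
have z1 : 0 <= 1 - normc z ^+ 2.
  by rewrite subr_ge0 expr_le1 ?normc_ge0// ltW//; exact/unit_diskP.
rewrite /blaschke big_cons normcM exprMn.
have m1 : normc (mobius a z) ^+ 2 <= 1.
  by rewrite expr_le1 ?normc_ge0// ltW//; exact/unit_diskP/mobius_disk.
have h1 := KP _ zD; have h2 := LP _ zD; rewrite /blaschke in h1.
set u := normc (mobius a z) ^+ 2 in m1 h2 *.
set v := normc _ ^+ 2 in h1 *; set w := 1 - normc z ^+ 2 in z1 h1 h2 *.
have u0 : 0 <= u by rewrite exprn_ge0// normc_ge0.
have : u * (1 - v) <= u * (K * w) by rewrite ler_wpM2l.
have : u * (K * w) <= K * w by rewrite ler_piMl// mulr_ge0.
by rewrite mulrDl; lra.
Qed.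

(** All that the rest of the argument retains of a Blaschke product with at least one factor. The
    third clause says that multiplication by [f] is a contraction of the Hardy space. *)
Definition inner_like (f : C -> C) :=
  [/\ forall z, D z -> derivable (f : C -> C^o) z 1,
      forall z, D z -> D (f z),
      psd D (fun x y => (1 - f x * (f y)^*) * szego x y) &
      exists2 K : R, 0 <= K & defect_le K f].

Lemma Blaschke_cases (f : C -> C) : is_Blaschke f ->
  (forall z, D z -> ~ D (f z)) \/ inner_like f.
Proof.
move=> [theta [N [a [aD fE]]]]; pose l := [seq a j | j <- enum 'I_N].
have lD : {in l, forall b, D b} by move=> _ /mapP[j _ ->].
pose c : C := cos theta +i* sin theta.
have c1 : normc c = 1 by exact: (normc_circ_pt theta).
have cc : c * c^* = 1 by rewrite -normcCK c1 expr1n.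
have {}fE z : D z -> f z = c * blaschke l z.
  by move=> zD; rewrite fE// /blaschke big_map big_enum.
have nf z : D z -> normc (f z) = normc (blaschke l z).
  by move=> zD; rewrite fE// normcM c1 mul1r.
case: N => [|N] in a l lD aD fE nf *.
  left=> z zD /unit_diskP; rewrite nf// /blaschke /l enum_ord0 /= big_nil.
  by rewrite normc1 ltxx.
right; split.
- move=> z zD; have h := derivable_blaschke lD zD.
  have h2 : derivable ((fun w => c * blaschke l w) : C -> C^o) z 1.
    exact: (derivableM (derivable_cst c z 1) h).
  (* [f] is given by the product on the disk only, so the derivative is transferred through a
     neighborhood of [z] inside the disk. *)
  apply: near_eq_derivable h2; have z1 : 0 < 1 - `|z| by rewrite subr_gt0.
  apply: filterS (nbhsx_ballx (z : C) _ z1) => w; rewrite -ball_normE /= => zw.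
  rewrite fE// /unit_disk /= -[w](subrK z) (le_lt_trans (ler_normD _ _))//.
  by rewrite distrC -ltrBrDr.
- move=> z zD; apply/unit_diskP; rewrite nf// /blaschke /l enum_ordSl /= big_cons.
  rewrite normcM; apply: (@le_lt_trans _ _ (normc (mobius (a ord0) z))).
    rewrite ler_piMr ?normc_ge0// -/(blaschke _ z) blaschke_le1//.
    by move=> b /mapP[j _ ->].
  by apply/unit_diskP/mobius_disk.
- apply: eq_psd (psd_blaschke lD) => x y xD yD.
  by rewrite !fE// rmorphM /= mulrACA cc mul1r.
have [K K0 KP] := blaschke_defect lD.
by exists K => // z zD; rewrite nf// KP.
Qed.

(* Littlewood subordination and Pick's theorem, combined. *)
Lemma psd_weighted_composition (f G : C -> C) (B : R) : inner_like f ->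
  (forall z, D z -> derivable (G : C -> C^o) z 1) ->
  (forall z, D z -> normc (G z) <= B) ->
  exists2 c : R, 0 < c & psd D (fun x y =>
    c%:C * szego x y - G x * (G y)^* * szego (f x) (f y)).
Proof.
move=> [df fD fpsd _] dG GB.
have D0 : D 0 by apply/unit_diskP; rewrite normc0.
pose b := f 0; have bD : D b by exact: fD.
have b1 : normc b < 1 by exact/unit_diskP.
pose h z := (1 - b^* * f z)^-1; pose F z := mobius b (f z).
have FD z : D z -> D (F z) by move=> /fD fzD; exact: mobius_disk.
have F0 : F 0 = 0 by rewrite /F /mobius -/b subrr mul0r.
have Fk x y : D x -> D y -> 1 - F x * (F y)^* =
    (1 - b * b^*) * (h x * (1 - f x * (f y)^*) * (h y)^*).
  by move=> xD yD; rewrite /F mobius_kernel//; exact: fD.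
have Fpsd : psd D (fun x y => (1 - F x * (F y)^*) * szego x y).
  apply: eq_psd (psdZ (disk_ge0 bD) (psd_mulr1 h fpsd)) => x y xD yD.
  by rewrite Fk//; ring.
have Fsub : psd D (fun x y => szego x y - szego (F x) (F y)).
  have F1 : psd D (fun x y => (1 - F x * (F y)^*) * szego x y - 1).
    apply: (psd_subr1 D0 _ _ Fpsd).
      by rewrite F0 /szego !mul0r subr0 invr1 mulr1.
    by move=> x _; rewrite F0 /szego rmorph0 !mul0r !mulr0 subr0 invr1 mulr1.
  (* The factor [szego (F x) (F y)] cancels [1 - F x (F y)^*]. *)
  apply: eq_psd (psd_mul_szego FD F1) => x y xD yD; rewrite /szego.
  by field; rewrite !szegoV_neq0 //; exact: FD.
have d0 : 0 < 1 - normc b by rewrite subr_gt0.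
have hB z : D z -> normc (h z) <= (1 - normc b)^-1.
  move=> zD; rewrite /h normcV lef_pV2 ?posrE//; last first.
    rewrite lt_neqAle normc_ge0 andbT eq_sym.
    by apply: contra (szegoV_neq0' bD (fD _ zD)) => /eqP/eq0_normc ->.
  have := le_normcD (1 - b^* * f z) (b^* * f z).
  rewrite subrK normc1 normcM normc_conj.
  have : normc b * normc (f z) <= normc b.
    by rewrite ler_piMr ?normc_ge0// ltW//; exact/unit_diskP/fD.
  by lra.
have B0 : 0 <= B := le_trans (normc_ge0 _) (GB _ D0).
pose B' := (B + 1) / (1 - normc b).
have B'0 : 0 < B' by rewrite divr_gt0//; lra.
have dGh z : D z -> derivable ((fun w => G w * h w) : C -> C^o) z 1.
  move=> zD; have h1 : derivable ((fun w => 1 - b^* * f w) : C -> C^o) z 1.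
    exact: (derivableB (derivable_cst (1 : C) z 1)
      (derivableM (derivable_cst (b^* : C) z 1) (df _ zD))).
  have h2 := @derivableV C C (fun w => 1 - b^* * f w) z 1
    (szegoV_neq0' bD (fD _ zD)) h1.
  exact: (derivableM (dG _ zD) h2).
have GhB z : D z -> normc (G z * h z) <= B'.
  move=> zD; rewrite normcM ler_pM ?normc_ge0 ?hB//.
  by have := GB _ zD; lra.
exists ((1 - normc b ^+ 2) * B' ^+ 2).
  by rewrite mulr_gt0 ?exprn_gt0// subr_gt0 expr_lt1 ?normc_ge0.
(* With [H = G h], the terms [H H^* s] cancel in [(B'^2 - H H^* ) s + H (s - s(F, F)) H^*], and
   [1 - |b|^2] turns [H s(F, F) H^*] into [G s(f, f) G^*]. *)
have := psdZ (disk_ge0 bD) (psdD (Pick_disk dGh GhB)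
  (psd_mulr1 (fun z => G z * h z) Fsub)).
apply: eq_psd => x y xD yD.
have -> : szego (F x) (F y) = (1 - b * b^*)^-1 *
    ((h x)^-1 * szego (f x) (f y) * ((h y)^-1)^*).
  rewrite /szego Fk//.
  by rewrite !invfM !fmorphV; ring.
have hx : h x != 0 by rewrite invr_eq0; exact: (szegoV_neq0' bD (fD _ xD)).
have hy : (h y)^* != 0.
  by rewrite conjC_eq0 invr_eq0; exact: (szegoV_neq0' bD (fD _ yD)).
have -> : ((1 - normc b ^+ 2) * B' ^+ 2)%:C = (1 - b * b^*) * B'%:C ^+ 2 :> C.
  rewrite -defect_complex [LHS]rmorphM; congr (_ * _); exact: rmorphXn.
rewrite [(G y * h y)^*]rmorphM [((h y)^-1)^*]fmorphV /=.
by field; rewrite hx hy szegoV_neq0.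
Qed.

End Blaschke.

(** * Extension of a functional by one dimension *)

Section Extension.
Context {R : realType}.
Local Notation C := (Cplx R).
Local Notation I := (0 +i* 1 : C).

Lemma complex_cauchy_cvg (u : nat -> C) :
  (forall e : R, 0 < e -> exists N, forall m n, (N <= m)%N -> (N <= n)%N ->
    normc (u m - u n) <= e) ->
  exists l : C, u n @[n --> \oo] --> l.
Proof.
move=> uc.
have real (v : nat -> R) : (forall m n, `|v m - v n| <= normc (u m - u n)) ->
    cvgn v.
  move=> vu; apply: cauchy_cvg; apply: cauchy_exP => e e0.
  have e20 : 0 < e / 2 by rewrite divr_gt0.
  have [N NP] := uc _ e20; exists (v N), N => // n /= Nn.
  rewrite -ball_normE /=; apply: le_lt_trans (vu _ _) _.
  by apply: le_lt_trans (NP _ _ (leqnn N) Nn) _; lra.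
have Rle (z : C) : `|complex.Re z| <= normc z.
  by case: z => a b; rewrite -sqrtr_sqr ler_sqrt ?lerDl ?addr_ge0 ?sqr_ge0.
have Ile (z : C) : `|complex.Im z| <= normc z.
  by case: z => a b; rewrite -sqrtr_sqr ler_sqrt ?lerDr ?addr_ge0 ?sqr_ge0.
have /cvg_ex[a /= ua] : cvgn (fun n => complex.Re (u n)).
  apply: real => m n; apply: le_trans (Rle _).
  by case: (u m) => ? ?; case: (u n) => ? ?.
have /cvg_ex[b /= ub] : cvgn (fun n => complex.Im (u n)).
  apply: real => m n; apply: le_trans (Ile _).
  by case: (u m) => ? ?; case: (u n) => ? ?.
exists (a +i* b); apply/normc_cvgP => e e0.
have e20 : 0 < e / 2 by rewrite divr_gt0.
move/cvgrPdist_le : ua => /(_ _ e20) ua; move/cvgrPdist_le : ub => /(_ _ e20) ub.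
near=> n.
have -> : u n - (a +i* b : C) =
    (complex.Re (u n) - a)%:C + I * (complex.Im (u n) - b)%:C.
  have -> : (a +i* b : C) = a%:C + I * b%:C := complexE _.
  by rewrite [u n in LHS]complexE !rmorphB /=; ring.
apply: le_trans (le_normcD _ _) _; rewrite normcM normcI mul1r !normc_real.
rewrite (distrC _ a) (distrC _ b) [e](_ : e = e / 2 + e / 2); last by field.
by apply: lerD; near: n.
Unshelve. all: by end_near. Qed.

Lemma normc_cvg (u : nat -> C) (l : C) :
  u n @[n --> \oo] --> l -> normc (u n) @[n --> \oo] --> normc l.
Proof.
move=> /normc_cvgP ul; apply/cvgrPdist_le => e /ul; apply: filterS => n.
have := le_normcD (u n - l) l; have := le_normcD (l - u n) (u n).
by rewrite !subrK ler_norml [normc (l - _)]normcB; lra.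
Qed.

(** Antilinear in the coefficients, so that its squared modulus is the form of the rank one kernel
    [l x (l y)^*]. *)
Definition lform (T : Type) (l : T -> C) (s : seq (T * C)) : C :=
  \sum_(x <- s) l x.1 * x.2^*.

Definition sform (T : Type) (k : T -> T -> C) (s t : seq (T * C)) : C :=
  \sum_(x <- s) \sum_(y <- t) k x.1 y.1 * y.2 * x.2^*.

Definition scale_family (T : Type) (a : C) (s : seq (T * C)) :=
  [seq (x.1, a * x.2) | x <- s].

Lemma lform_cat (T : Type) (l : T -> C) s t :
  lform l (s ++ t) = lform l s + lform l t.
Proof. exact: big_cat. Qed.

Lemma lform_scale (T : Type) (l : T -> C) a s :
  lform l (scale_family a s) = a^* * lform l s.
Proof.
rewrite /lform big_map mulr_sumr; apply: eq_bigr => x _ /=.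
by rewrite rmorphM /=; ring.
Qed.

Lemma sform_catl (T : Type) (k : T -> T -> C) s s' t :
  sform k (s ++ s') t = sform k s t + sform k s' t.
Proof. exact: big_cat. Qed.

Lemma sform_catr (T : Type) (k : T -> T -> C) s t t' :
  sform k s (t ++ t') = sform k s t + sform k s t'.
Proof.
by rewrite /sform -big_split; apply: eq_bigr => x _; rewrite big_cat.
Qed.

Lemma sform_scalel (T : Type) (k : T -> T -> C) a s t :
  sform k (scale_family a s) t = a^* * sform k s t.
Proof.
rewrite /sform big_map mulr_sumr; apply: eq_bigr => x _ /=.
rewrite mulr_sumr; apply: eq_bigr => y _.
by rewrite rmorphM /=; ring.
Qed.

Lemma sform_scaler (T : Type) (k : T -> T -> C) a s t :
  sform k s (scale_family a t) = a * sform k s t.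
Proof.
rewrite /sform mulr_sumr; apply: eq_bigr => x _.
rewrite big_map mulr_sumr; apply: eq_bigr => y _ /=.
ring.
Qed.

Lemma qform_sform (T : Type) (k : T -> T -> C) s : qform k s = sform k s s.
Proof. by []. Qed.

Lemma qform_cons (T : Type) (k : T -> T -> C) x s :
  qform k (x :: s) = sform k [:: x] [:: x] + sform k [:: x] s +
    sform k s [:: x] + sform k s s.
Proof. by rewrite -cat1s qform_sform sform_catl !sform_catr; ring. Qed.

Lemma scale_family_in (T : eqType) (A : set T) a s :
  {in s, forall x : T * C, A x.1} -> {in scale_family a s, forall x : T * C, A x.1}.
Proof. by move=> sA _ /mapP[x xs ->]; exact: (sA _ xs). Qed.

Lemma cat_in (T : eqType) (A : set T) s t :
  {in s, forall x : T * C, A x.1} -> {in t, forall x : T * C, A x.1} ->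
  {in s ++ t, forall x : T * C, A x.1}.
Proof. by move=> sA tA x; rewrite mem_cat => /orP[/sA|/tA]. Qed.

(* Hahn-Banach extension by one dimension for the seminorm of [Q]: the value of
   the functional [l] at [o] is its limit along a sequence minimizing the
   distance from [- o] to the span of [A]. *)
Lemma extend_functional (T : eqType) (A : set T) (Q : T -> T -> C) (l : T -> C)
    (o : T) :
  psd (A `|` [set o]) Q -> psd A (fun x y => Q x y - l x * (l y)^*) ->
  exists lam : C, forall (c : C) s, {in s, forall x, A x.1} ->
    `|lam * c^* + lform l s| ^+ 2 <= qform Q ((o, c) :: s).
Proof.
move=> QA lA; pose inA (s : seq (T * C)) := {in s, forall x, A x.1}.
pose N s := qform Q ((o, 1) :: s).
have N0 s : inA s -> 0 <= N s.
  move=> sA; apply: QA => x; rewrite in_cons => /orP[/eqP ->|/sA]; first by right.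
  by left.
have lq s : inA s -> `|lform l s| ^+ 2 <= qform Q s.
  move=> sA; have := lA s sA.
  have -> : qform (fun x y => Q x y - l x * (l y)^*) s =
      qform Q s - `|lform l s| ^+ 2.
    rewrite -qform_rank1 -mulN1r -qformZ -qformD.
    by congr qform; apply/funext => x; apply/funext => y; rewrite mulN1r.
  by rewrite subr_ge0.
(* Weighted parallelogram identity; concatenation of families acts as addition of vectors. *)
have convex s t (th : C) : th^* = th ->
    N (scale_family (1 - th) s ++ scale_family th t) =
    (1 - th) * N s + th * N t - th * (1 - th) * qform Q (s ++ scale_family (-1) t).
  move=> thR; rewrite /N !qform_cons !(qform_sform _ (s ++ _)).
  rewrite !(sform_catl, sform_catr, sform_scalel, sform_scaler).
  by rewrite rmorphB rmorphN rmorph1 /= thR; ring.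
pose E := [set complex.Re (N s) | s in inA].
have E0 : has_inf E.
  split; first by exists (complex.Re (N [::])), [::].
  by exists 0 => _ [s sA <-]; have := N0 _ sA; rewrite lecE => /andP[].
have NE s : inA s -> N s = (complex.Re (N s))%:C.
  by move=> sA; rewrite RRe_real// realE N0.
have infE s : inA s -> (inf E)%:C <= N s.
  by move=> sA; rewrite (NE _ sA) lecR; apply: ge_inf; [exact: E0.2|exists s].
have inf0 : 0 <= inf E.
  by apply: lb_le_inf; [exact: E0.1|move=> _ [s sA <-]];
    have := N0 _ sA; rewrite lecE => /andP[].
have near_min n : exists s, inA s /\ N s <= (inf E + harmonic n)%:C.
  have [_ [s sA <-] h] := inf_adherent (harmonic_gt0 n) E0.
  by exists s; split=> //; rewrite (NE _ sA) lecR ltW.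
have [m mP] := choice near_min.
(* The combination of [s] and [t] cannot beat the infimum, so the values of [l] at two near
   minimizers are close; [th = 1/2] makes them a Cauchy sequence. *)
have gap s t (th : R) : inA s -> inA t -> 0 <= th <= 1 ->
    (th * (1 - th))%:C * `|lform l s - lform l t| ^+ 2 <=
    (1 - th)%:C * N s + th%:C * N t - (inf E)%:C.
  move=> sA tA /andP[th0 th1].
  have stA : inA (s ++ scale_family (-1) t) by apply: cat_in => //; exact: scale_family_in.
  have := lq _ stA; rewrite lform_cat lform_scale rmorphN rmorph1 mulN1r => h.
  have thR : (th%:C : C)^* = th%:C by exact: conjc_real.
  have := infE (scale_family (1 - th%:C) s ++ scale_family th%:C t).
  rewrite convex// => {}infE.
  have {}infE := infE (cat_in (scale_family_in sA) (scale_family_in tA)).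
  have thp : 0 <= (th * (1 - th))%:C :> C by rewrite ler0c mulr_ge0// subr_ge0.
  apply: le_trans (ler_wpM2l thp h) _.
  have -> : (th * (1 - th))%:C = th%:C * (1 - th%:C) :> C.
    by rewrite rmorphM rmorphB rmorph1.
  have -> : (1 - th)%:C = 1 - th%:C :> C by rewrite rmorphB rmorph1.
  by rewrite lerBrDr addrC -lerBrDr.
have gapR s t (th x y : R) : inA s -> inA t -> 0 <= th <= 1 ->
    N s <= x%:C -> N t <= y%:C ->
    th * (1 - th) * normc (lform l s - lform l t) ^+ 2 <=
      (1 - th) * x + th * y - inf E.
  move=> sA tA th01 sx ty; have /andP[th0 th1] := th01.
  rewrite -lecR.
  have -> : (th * (1 - th) * normc (lform l s - lform l t) ^+ 2)%:C =
      (th * (1 - th))%:C * `|lform l s - lform l t| ^+ 2 :> C.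
    by rewrite [LHS]rmorphM; congr (_ * _); exact: rmorphXn.
  apply: le_trans (gap _ _ _ sA tA th01) _.
  have -> : ((1 - th) * x + th * y - inf E)%:C =
      (1 - th)%:C * x%:C + th%:C * y%:C - (inf E)%:C :> C.
    by rewrite [LHS]rmorphB; congr (_ - _); rewrite [LHS]rmorphD; congr (_ + _);
      exact: rmorphM.
  rewrite lerD2r lerD// ler_wpM2l// ler0c//.
  by rewrite subr_ge0.
have [lam lamP] : exists lam : C, lform l (m n) @[n --> \oo] --> lam.
  apply: (@complex_cauchy_cvg (fun n => lform l (m n))) => e e0.
  have e40 : 0 < e ^+ 2 / 4 by rewrite divr_gt0// exprn_gt0.
  have /cvgrPdist_lt/(_ _ e40) [M _ MP] : harmonic @ \oo --> (0 : R) := @cvg_harmonic R.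
  exists M => i j /MP /=; rewrite sub0r normrN ger0_norm ?harmonic_ge0// => hi.
  move=> /MP /=; rewrite sub0r normrN ger0_norm ?harmonic_ge0// => hj.
  have half : 0 <= (2^-1 : R) <= 1 by lra.
  have := gapR _ _ _ _ _ (mP i).1 (mP j).1 half (mP i).2 (mP j).2.
  move=> h; rewrite -(@ler_pXn2r _ 2) ?nnegrE ?normc_ge0 ?(ltW e0)//.
  have {}hi : harmonic i < e ^+ 2 / 4 := hi.
  have {}hj : harmonic j < e ^+ 2 / 4 := hj.
  by lra.
have key s : inA s -> `|lam - lform l s| ^+ 2 <= N s.
  move=> sA; rewrite (NE _ sA).
  have -> : `|lam - lform l s| ^+ 2 = (normc (lam - lform l s) ^+ 2)%:C.
    by apply/esym; exact: rmorphXn.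
  rewrite lecR; set X := normc _; set y := complex.Re _.
  have yi : inf E <= y by rewrite -lecR /y -(NE _ sA) infE.
  rewrite leNgt; apply/negP => yX.
  have X20 : 0 < X ^+ 2 by lra.
  (* Along the minimizing sequence [gapR] gives [(1 - th) X^2 <= y] in the limit; this [th] makes
     the left side the midpoint of [y] and [X^2], which exceeds [y]. *)
  pose th := (1 - y / X ^+ 2) / 2.
  have yX1 : y / X ^+ 2 < 1 by rewrite ltr_pdivrMr// mul1r.
  have yX0 : 0 <= y / X ^+ 2 by rewrite divr_ge0 ?(ltW X20)// (le_trans inf0).
  have th0 : 0 < th by rewrite /th; lra.
  have th1 : 0 <= th <= 1 by rewrite /th; lra.
  have thX : (1 - th) * X ^+ 2 = (X ^+ 2 + y) / 2.
    by rewrite /th; field; rewrite -sqrf_eq0 gt_eqF.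
  pose v n := (1 - th) * normc (lform l (m n) - lform l s) ^+ 2 - th^-1 * harmonic n.
  have vX : v n @[n --> \oo] --> (1 - th) * X ^+ 2 - th^-1 * 0.
    apply: cvgB; last by apply: cvgM; [exact: cvg_cst|exact: cvg_harmonic].
    apply: cvgM; first exact: cvg_cst.
    have nX : normc (lform l (m n) - lform l s) @[n --> \oo] --> X.
      exact: (normc_cvg (cvgB lamP (cvg_cst (lform l s)))).
    exact: (cvgM nX nX).
  have : (1 - th) * X ^+ 2 - th^-1 * 0 <= y.
    apply: cvgr_to_le vX _; near=> n.
    have [mA mN] := mP n.
    have := gapR _ _ _ _ _ mA sA th1 mN _ => /(_ y); rewrite -(NE _ sA) => /(_ (lexx _)).
    move=> h; rewrite /v -(ler_pM2l th0) mulrBr (mulrA th th^-1) divff ?gt_eqF// mul1r mulrA.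
    have : 0 <= th * harmonic n by rewrite mulr_ge0 ?harmonic_ge0// ltW.
    have : 0 <= th * inf E by rewrite mulr_ge0// ltW.
    by lra.
  by rewrite mulr0 subr0 thX; lra.
(* Minimizers approach [- o], so the value at [o] is the opposite of the limit. A nonzero [c] is
   reduced to 1 by homogeneity. *)
exists (- lam) => c s sA.
have [->|c0] := eqVneq c 0.
  rewrite rmorph0 mulr0 add0r; apply: le_trans (lq _ sA) _.
  rewrite qform_cons qform_sform.
  rewrite (_ : [:: (o, 0)] = scale_family 0 [:: (o, 0)]); last by rewrite /scale_family /= mul0r.
  rewrite !(sform_catl, sform_catr, sform_scalel, sform_scaler).
  by rewrite rmorph0 !mul0r !add0r.
have csA : inA (scale_family c^-1 s) by exact: scale_family_in.
have -> : (o, c) :: s = scale_family c ((o, 1) :: scale_family c^-1 s).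
  rewrite /scale_family /= mulr1 -map_comp; congr cons.
  rewrite -[LHS]map_id; apply: eq_map => -[x d] /=.
  by rewrite mulVKf.
have -> : - lam * c^* + lform l s = - c^* * (lam - lform l (scale_family c^-1 s)).
  by rewrite lform_scale fmorphV; field; rewrite conjC_eq0.
rewrite qform_sform sform_scalel sform_scaler -qform_sform -/(N _).
rewrite normrM normrN norm_conjC exprMn normCK mulrA [c^* * c]mulrC.
by rewrite ler_wpM2l ?mul_conjC_ge0// key.
Unshelve. all: by end_near. Qed.

End Extension.

(** * From matrix kernels to scalar kernels *)

Section Delta.
Context {R : realType}.
Local Notation C := (Cplx R).
Local Notation D := (unit_disk R).

Definition Delta00 (f g : C -> C) (M : R) (x y : C) : C :=
  M%:C ^+ 2 * alpha_sq f * szego x y - g x * (g y)^* * szego (f x) (f y).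

Lemma iter_orbit (S : set C) (f : C -> C) n z :
  (forall w, S w -> forward_orbit f w `<=` S) -> S z -> S (iter n f z).
Proof. by move=> Sf Sz; apply: Sf Sz _ _; exists n. Qed.

Lemma psd_kernel_Delta (S : set C) (f g : C -> C) (M : R) :
  (forall w, S w -> forward_orbit f w `<=` S) ->
  (forall z, S z -> g (f z) = g z) ->
  psd S (Delta00 f g M) -> psd_kernel S (period f) (Delta f g M).
Proof.
move=> Sf gf kS m z c zS _ V VE.
have giter n w : S w -> g (iter n f w) = g w.
  by move=> Sw; elim: n => //= n IHn; rewrite gf//; exact: iter_orbit.
have DE i k j l : Delta f g M (z i) (z k) j l =
    Delta00 f g M (iter j f (z i)) (iter l f (z k)).
  by rewrite /Delta /Delta00 !giter.
(* The square partial sums of the matrix form are forms of [Delta00] over the first [N] points of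
   each orbit; points repeated on a periodic orbit are allowed. *)
pose sN N := [seq (iter j f (z i), c i j) | i <- enum 'I_m, j <- iota 0 N].
have sNS N : {in sN N, forall x, S x.1}.
  by move=> _ /allpairsP[[i j] [_ _ ->]]; exact: iter_orbit.
have sumE (F : C * C -> C) N : \sum_(x <- sN N) F x =
    \sum_(i < m) \sum_(j < N) F (iter j f (z i), c i j).
  rewrite big_allpairs_dep /= big_enum; apply: eq_bigr => i _.
  by rewrite -[in LHS](subn0 N) -/(index_iota 0 N) big_mkord.
apply: (@cvg_ge0 _ (fun N => qform (Delta00 f g M) (sN N))) => [N|].
  exact: kS.
have lim : \sum_(i < m) \sum_(k < m) (\sum_(j < N) \sum_(l < N)
    Delta f g M (z i) (z k) j l * c k l * (c i j)^*) @[N --> \oo] -->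
    \sum_(i < m) \sum_(k < m) V i k.
  by apply: cvg_sum_seq => i _; apply: cvg_sum_seq => k _; exact: VE.
apply: (eq_cvgn lim) => N.
rewrite /qform sumE; apply: eq_bigr => i _.
under eq_bigr do rewrite sumE.
rewrite exchange_big; apply: eq_bigr => k _.
by apply: eq_bigr => j _; apply: eq_bigr => l _ /=; rewrite DE.
Qed.

Lemma period_gt0 (T : eqType) (f : T -> T) z n :
  period f z = Some n -> (0 < n)%N.
Proof.
rewrite /period; case: pselect => // h [<-].
by case: ex_minnP => k /andP[].
Qed.

Lemma psd_of_psd_kernel (S : set C) (f g : C -> C) (M : R) :
  psd_kernel S (period f) (Delta f g M) -> psd S (Delta00 f g M).
Proof.
move=> kS s sS.
pose x i := tnth (in_tuple s) i.
(* Index 0 is below every period, so these vectors are admissible; their partial sums are constant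
   from 1 on. *)
pose c (i : 'I_(size s)) (j : nat) := if j == 0%N then (x i).2 else 0.
have c0 i : c i 0%N = (x i).2 by [].
have cS i j : c i j.+1 = 0 by [].
have zS i : S (x i).1 by apply: sS; exact: mem_tnth.
have cC i : in_Cpow (period f (x i).1) (c i).
  split=> [n j /period_gt0 n0 nj|].
    by rewrite /c gtn_eqF// (leq_trans n0).
  apply: (cvgP (`|(x i).2| ^+ 2 : C^o)).
  apply/normc_cvgP => e e0; exists 1%N => // -[//|n] _.
  rewrite /series [X in normc (X - _)]big_nat_recl// big1 ?addr0 => [|k _].
    by rewrite c0 subrr normc0 ltW.
  by rewrite cS normr0 expr0n.
have := kS _ (fun i => (x i).1) c zS cC
  (fun i k => Delta f g M (x i).1 (x k).1 0 0 * (x k).2 * (x i).2^*).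
have -> : qform (Delta00 f g M) s = \sum_(i < size s) \sum_(k < size s)
    Delta f g M (x i).1 (x k).1 0 0 * (x k).2 * (x i).2^*.
  by rewrite /qform big_tnth; apply: eq_bigr => i _; rewrite big_tnth.
move=> h.
apply: h => i k; apply/normc_cvgP => e e0; exists 1%N => // -[//|n] _.
rewrite big_ord_recl big_ord_recl !c0.
rewrite big1 => [|j _]; last by rewrite cS mulr0 mul0r.
rewrite big1 => [|j _]; last by rewrite big1 // => l _; rewrite cS rmorph0 mulr0.
by rewrite !addr0 subrr normc0 ltW.
Qed.

Lemma alpha_sqE (f : C -> C) : D (f 0) ->
  exists2 a : R, 0 < a & alpha_sq f = a%:C.
Proof.
move=> /unit_diskP f0; have n0 := normc_ge0 (f 0).
exists ((1 + normc (f 0)) / (1 - normc (f 0))); first by rewrite divr_gt0; lra.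
rewrite /alpha_sq -[`|f 0|]/((normc (f 0))%:C).
by rewrite [RHS]rmorphM fmorphV rmorphD rmorphB rmorph1.
Qed.

End Delta.

(** * Holomorphy of functions dominated by the Szego kernel *)

Section Differentiability.
Context {R : realType}.
Local Notation C := (Cplx R).
Local Notation D := (unit_disk R).

(** The form is the squared Hardy norm of a combination of Szego kernels, hence at most the square
    of its supremum on the circle. *)
Lemma qform_szego_le (s : seq (C * C)) (b : R) : {in s, forall x, D x.1} ->
  (forall z, z * z^* = 1 ->
    normc (\sum_(x <- s) (1 - x.1 * z^*)^-1 * x.2^*) <= b) ->
  qform szego s <= (b ^+ 2)%:C.
Proof.
move=> sD hb; rewrite -subr_ge0.
pose kn n (x y : C) : C := circle_mean n
  (fun z => (1 - x * z^*)^-1 * 1 * (1 - y^* * z)^-1).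
have lim : (b ^+ 2)%:C - qform (kn n) s @[n --> \oo] -->
    ((b ^+ 2)%:C - qform szego s : C).
  have h : qform (kn n) s @[n --> \oo] --> qform szego s.
    apply: cvg_sum_seq => x xs; apply: cvg_sum_seq => y ys.
    apply: cvg_mulr; apply: cvg_mulr.
    have := Cauchy_szego (f := fun=> 1) (sD _ xs) (sD _ ys)
      (fun z _ => derivable_cst _ _ _).
    by rewrite mul1r.
  exact: (cvgB (cvg_cst _) h).
apply: cvg_ge0 lim => n; rewrite subr_ge0.
have -> : qform (kn n) s = circle_mean n (fun z =>
    `|\sum_(x <- s) (1 - x.1 * z^*)^-1 * x.2^*| ^+ 2).
  rewrite /qform /kn /circle_mean /dyadic_mean.
  under eq_bigr do under eq_bigr do rewrite -mulrA -mulrA mulr_suml.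
  under eq_bigr do rewrite -mulr_sumr.
  rewrite -mulr_sumr; congr (_ * _).
  under eq_bigr do rewrite exchange_big /=.
  rewrite exchange_big /=; apply: eq_bigr => k _.
  rewrite -(qform_rank1 (fun x => (1 - x * (circ_pt _)^*)^-1)) /qform.
  apply: eq_bigr => x _; apply: eq_bigr => y _.
  by rewrite -(szego_conj y.1) conjCK; ring.
have : normc (circle_mean n (fun z =>
    `|\sum_(x <- s) (1 - x.1 * z^*)^-1 * x.2^*| ^+ 2) - circle_mean n (fun=> 0))
    <= b ^+ 2.
  apply: normc_circle_meanB => t _.
  rewrite subr0 normcM -[normc `|_|]/(normc (normc _)%:C) normc_real.
  rewrite ger0_norm ?normc_ge0// -expr2.
  have b0 := hb (circ_pt t); rewrite -normcCK normc_circ_pt expr1n in b0.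
  have {}b0 := b0 erefl.
  by rewrite lerXn2r ?nnegrE ?normc_ge0// (le_trans _ b0) ?normc_ge0.
rewrite circle_mean_cst subr0 -lecR; apply: le_trans.
have X0 : 0 <= circle_mean n (fun z =>
    `|\sum_(x <- s) (1 - x.1 * z^*)^-1 * x.2^*| ^+ 2).
  apply: mulr_ge0; first by rewrite invr_ge0 exprn_ge0// ler0n.
  by apply: sumr_ge0 => k _; rewrite exprn_ge0.
by rewrite -{1}(ger0_norm X0).
Qed.

Definition slope (G : C -> C) (p z : C) : C := (G z - G p) * (z - p)^-1.

(* The difference of the two slopes is a functional in the values of [G] at
   [z], [w] and [p]; the corresponding combination of Szego kernels is
   (z - w) u^2 / ((1 - z u) (1 - w u) (1 - p u)) at u^*. *)
Lemma psd_slope_le (G : C -> C) (c : R) : 0 < c ->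
  psd D (fun x y => c%:C * szego x y - G x * (G y)^*) ->
  forall (rho : R) (p z w : C), rho < 1 ->
    normc p <= rho -> normc z <= rho -> normc w <= rho ->
    z != p -> w != p ->
  normc (slope G p z - slope G p w) <=
    (c + 1) * (1 - rho) ^- 3 * normc (z - w).
Proof.
move=> c0 kD rho p z w r1 pr zr wr zp wp.
have zp0 : z - p != 0 by rewrite subr_eq0.
have wp0 : w - p != 0 by rewrite subr_eq0.
have DR x : normc x <= rho -> D x by move=> xr; apply/unit_diskP; lra.
pose s := [:: (z, ((z - p)^-1)^*); (w, (- (w - p)^-1)^*);
  (p, ((w - p)^-1 - (z - p)^-1)^*)].
have sD : {in s, forall x, D x.1}.
  by move=> x; rewrite !inE => /or3P[] /eqP ->; exact: DR.
have G_s : \sum_(x <- s) G x.1 * x.2^* = slope G p z - slope G p w.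
  by rewrite /s !big_cons big_nil /= !conjCK /slope; ring.
pose b := (1 - rho) ^- 3 * normc (z - w).
have r0 : 0 < 1 - rho by lra.
have b0 : 0 <= b.
  by rewrite mulr_ge0 ?normc_ge0// invr_ge0 exprn_ge0// ltW.
have hb u : u * u^* = 1 ->
    normc (\sum_(x <- s) (1 - x.1 * u^*)^-1 * x.2^*) <= b.
  move=> uu; have u1 : normc u^* = 1 by rewrite normc_conj normc_unit.
  have kle x : normc x <= rho -> normc (1 - x * u^*)^-1 <= (1 - rho)^-1.
    move=> xr; rewrite normcV.
    have h : 1 - rho <= normc (1 - x * u^*).
      have := le_normcD (1 - x * u^*) (x * u^*).
      by rewrite subrK normc1 normcM u1 mulr1; lra.
    by rewrite lef_pV2 ?posrE//; lra.
  have k0 x : normc x <= rho -> 1 - x * u^* != 0.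
    by move=> xr; apply: szego_neq0; rewrite ?u1//; lra.
  have -> : \sum_(x <- s) (1 - x.1 * u^*)^-1 * x.2^* =
      (1 - z * u^*)^-1 * (1 - w * u^*)^-1 * (1 - p * u^*)^-1 *
      (z - w) * u^* * u^*.
    rewrite /s !big_cons big_nil /= !conjCK.
    by field; rewrite zp0 wp0 !k0.
  rewrite !normcM u1 !mulr1 /b ler_wpM2r ?normc_ge0//.
  rewrite -exprVn !exprS expr0 mulr1 mulrA.
  by do ?[apply: ler_pM]; rewrite ?mulr_ge0 ?normc_ge0 ?kle.
have q := qform_szego_le sD hb.
have := kD s sD.
have -> : qform (fun x y => c%:C * szego x y - G x * (G y)^*) s =
    c%:C * qform szego s - `|slope G p z - slope G p w| ^+ 2.
  rewrite -G_s -qform_rank1 -mulN1r -!qformZ -qformD.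
  by congr qform; apply/funext => x; apply/funext => y; rewrite mulN1r.
rewrite subr_ge0 => h1.
have h2 : `|slope G p z - slope G p w| ^+ 2 <= (c * b ^+ 2)%:C.
  rewrite rmorphM; apply: le_trans h1 _; apply: ler_wpM2l => //.
  by rewrite ler0c ltW.
have h3 : normc (slope G p z - slope G p w) ^+ 2 <= c * b ^+ 2.
  by rewrite -lecR; apply: le_trans h2; rewrite rmorphXn.
(* [c + 1] stands in for the square root of [c], as [c <= (c + 1)^2]. *)
have c10 : 0 <= c + 1 by lra.
rewrite -mulrA -/b -(@ler_pXn2r _ 2) ?nnegrE ?normc_ge0 ?(mulr_ge0 c10 b0)//.
apply: le_trans h3 _; rewrite [leRHS]exprMn ler_wpM2r ?exprn_ge0//.
by rewrite sqrrD expr1n; have := sqr_ge0 c; lra.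
Qed.

(** The slopes at [p] are Lipschitz on a punctured disk of radius [(1 - |p|) / 2] around [p], so
    they converge; the limit is found along the points [p + d / (n + 1)]. *)
Lemma psd_derivable (G : C -> C) (c : R) : 0 < c ->
  psd D (fun x y => c%:C * szego x y - G x * (G y)^*) ->
  forall p, D p -> derivable (G : C -> C^o) p 1.
Proof.
move=> c0 kD p /unit_diskP p1; have p0 := normc_ge0 p.
pose rho := (1 + normc p) / 2.
have rho1 : rho < 1 by rewrite /rho; lra.
have prho : normc p < rho by rewrite /rho; lra.
pose K := (c + 1) * (1 - rho) ^- 3.
have K0 : 0 < K by rewrite mulr_gt0 ?invr_gt0 ?exprn_gt0//; lra.
have lip z w : normc (z - p) <= rho - normc p -> normc (w - p) <= rho - normc p ->
    z != p -> w != p -> normc (slope G p z - slope G p w) <= K * normc (z - w).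
  have rhoP u : normc (u - p) <= rho - normc p -> normc u <= rho.
    by move=> up; have := le_normcD (u - p) p; rewrite subrK; lra.
  move=> zp wp; apply: (psd_slope_le c0 kD) => //; try exact: rhoP.
  exact: ltW.
pose d := rho - normc p; have d0 : 0 < d by rewrite subr_gt0.
pose u n : C := p + (d * harmonic n)%:C.
have dh n : 0 < d * harmonic n by rewrite mulr_gt0 ?harmonic_gt0.
have up n : normc (u n - p) = d * harmonic n.
  by rewrite /u addrC addKr normc_real gtr0_norm.
have ud n : normc (u n - p) <= rho - normc p.
  by rewrite up -/d ler_piMr ?(ltW d0)// /harmonic /= invf_le1 ?ler1n ?ltr0n.
have unp n : u n != p.
  rewrite -subr_eq0; apply/eqP => h; have := up n; rewrite h normc0 => h2.
  by have := dh n; rewrite -h2 ltxx.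
have [l lP] : exists l : C, slope G p (u n) @[n --> \oo] --> l.
  apply: (@complex_cauchy_cvg _ (fun n => slope G p (u n))) => e e0.
  have Kd0 : 0 < K * d by rewrite mulr_gt0.
  have e1 : 0 < e / (K * d) by rewrite divr_gt0.
  have /cvgrPdist_lt/(_ _ e1) [N _ NP] : harmonic @ \oo --> (0 : R) := @cvg_harmonic R.
  exists N => i j iN jN.
  have hh k : (N <= k)%N -> K * d * harmonic k < e.
    move=> /NP /=; rewrite sub0r normrN ger0_norm ?invr_ge0 ?ler0n// => h.
    by rewrite mulrC -ltr_pdivlMr.
  apply: le_trans (lip _ _ (ud i) (ud j) (unp i) (unp j)) _.
  have -> : u i - u j = (d * harmonic i - d * harmonic j)%:C.
    by rewrite /u rmorphB; ring.
  rewrite normc_real -mulrBr normrM (gtr0_norm d0) mulrA.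
  have := hh _ iN; have := hh _ jN.
  have : `|harmonic i - harmonic j| <= Num.max (harmonic i) (harmonic j) :> R.
    have := harmonic_gt0 (R := R) i; have := harmonic_gt0 (R := R) j.
    by rewrite ler_norml le_max; move=> *; case: (leP (harmonic i : R) (harmonic j)); lra.
  move=> h hj hi.
  apply: (@le_trans _ _ (K * d * Num.max (harmonic i) (harmonic j))).
    by rewrite ler_pM2l.
  by rewrite maxr_pMr ?(ltW Kd0)// ge_max (ltW hi) (ltW hj).
have near_l z : normc (z - p) <= rho - normc p -> z != p ->
    normc (slope G p z - l) <= K * normc (z - p).
  move=> zd zp.
  have un : u n @[n --> \oo] --> p.
    apply/normc_cvgP => e e0.
    have e1 : 0 < e / d by rewrite divr_gt0.
    have /cvgrPdist_lt/(_ _ e1) : harmonic @ \oo --> (0 : R) := @cvg_harmonic R.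
    apply: filterS => n; rewrite sub0r normrN ger0_norm ?harmonic_ge0// up => h.
    by rewrite mulrC -ler_pdivlMr// ltW.
  have h1 : normc (slope G p z - slope G p (u n)) @[n --> \oo] -->
      normc (slope G p z - l).
    exact: (normc_cvg (cvgB (cvg_cst _) lP)).
  have h2 : K * normc (z - u n) @[n --> \oo] --> K * normc (z - p).
    exact: (cvgM (cvg_cst K) (normc_cvg (cvgB (cvg_cst z) un))).
  apply: (ler_cvg_to h1 h2); near=> n.
  exact: lip.
have der : h^-1 *: ((G \o shift p) (h *: (1 : C)) - G p) @[h --> (0 : C)^'] --> (l : C^o).
  apply/cvgrPdist_le => _ /gt0_complex[e e0 ->].
  rewrite near_withinE.
  pose d2 := Num.min d (e / K).
  have d20 : 0 < d2 by rewrite lt_min d0 divr_gt0.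
  have d20' : 0 < d2%:C :> C by rewrite ltcR.
  apply: filterS (nbhsx_ballx (0 : C) _ d20') => h.
  rewrite -ball_normE /= sub0r normrN -[`|h|]/((normc h)%:C) ltcR lt_min.
  move=> /andP[hd he] h0.
  have -> : h^-1 *: (G (h *: (1 : C) + p) - G p) = slope G p (h + p).
    have e1 : h *: (1 : C^o) = h := mulr1 _.
    by rewrite /slope addrK e1 [h^-1 *: _]mulrC.
  rewrite -[`|_|]/((normc _)%:C) lecR normcB.
  have hp : h + p - p = h by rewrite addrK.
  apply: le_trans (near_l (h + p) _ _) _; rewrite ?hp//.
  - exact: ltW.
  - by rewrite -subr_eq0 hp.
  - by rewrite mulrC -ler_pdivlMr// ltW.
by apply/cvg_ex; exists l.
Unshelve. all: by end_near. Qed.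

End Differentiability.

(** * Interpolation *)

Section Interpolation.
Context {R : realType}.
Local Notation C := (Cplx R).
Local Notation D := (unit_disk R).

(* A kernel on pairs (z, w), where [w] stands for a value at [z]; a set of pairs
   on which it is nonnegative is the graph of a function. *)
Definition graph_kernel (f : C -> C) (c : R) (x y : C * C) : C :=
  c%:C * szego x.1 y.1 - x.2 * (y.2)^* * szego (f x.1) (f y.1).

(** Points where [a] vanishes drop out of the form. It serves for the Mobius factor that vanishes at
    the new point. *)
Lemma psd_mulr1_support (T : eqType) (A B : set T) (a : T -> C)
    (k : T -> T -> C) :
  (forall x, B x -> a x != 0 -> A x) -> psd A k ->
  psd B (fun x y => a x * k x y * (a y)^*).
Proof.
move=> aA kA s sB; pose s' := [seq x <- s | a x.1 != 0].
have -> : qform (fun x y => a x * k x y * (a y)^*) s =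
    qform (fun x y => a x * k x y * (a y)^*) s'.
  have drop (F : T * C -> C) : (forall x, a x.1 = 0 -> F x = 0) ->
      \sum_(x <- s) F x = \sum_(x <- s') F x.
    move=> F0; rewrite /s' big_filter [RHS]big_mkcond; apply: eq_bigr => x _.
    by case: eqP => // /F0.
  rewrite /qform drop => [|x ax]; last first.
    by rewrite big1 // => y _; rewrite ax !mul0r.
  apply: eq_bigr => x _; apply: drop => y ay.
  by rewrite ay rmorph0 mulr0 !mul0r.
apply: (psd_mulr1 a kA) => x; rewrite mem_filter => /andP[ax xs].
by apply: aA => //; exact: sB.
Qed.

(** All occurrences of [o] are merged into one, the only shape that [extend_functional] covers. *)
Lemma qform_gather (T : eqType) (A : set T) (o : T) (t : seq (T * C)) :
  {in t, forall x, (A `|` [set o]) x.1} ->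
  exists c s, {in s, forall x : T * C, A x.1} /\
    forall k : T -> T -> C, qform k t = qform k ((o, c) :: s).
Proof.
move=> tA.
have [c [s [sA E]]] : exists c s, {in s, forall x : T * C, A x.1} /\
    forall F : T -> C, \sum_(x <- t) F x.1 * x.2 =
      \sum_(x <- (o, c) :: s) F x.1 * x.2.
  elim: t tA => [|x t IHt] tA.
    exists 0, [::]; split=> // F.
    by rewrite !big_cons !big_nil mulr0 addr0.
  have [|c [s [sA E]]] := IHt; first by move=> y yt; apply: tA; rewrite in_cons yt orbT.
  have [xA|xo] := tA x (mem_head _ _).
    exists c, (x :: s); split=> [y|F].
      by rewrite in_cons => /orP[/eqP ->|/sA].
    by rewrite !big_cons E big_cons addrCA.
  exists (c + x.2), s; split=> // F.
  by rewrite !big_cons E big_cons xo /= addrA mulrDr [X in X + _]addrC.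
exists c, s; split=> // k.
have Ec (F : T -> C) : \sum_(x <- t) F x.1 * x.2^* =
    \sum_(x <- (o, c) :: s) F x.1 * x.2^*.
  have := congr1 Num.conj (E (fun x => (F x)^*)); rewrite !rmorph_sum.
  by under eq_bigr do rewrite rmorphM /= conjCK;
    under [in RHS]eq_bigr do rewrite rmorphM /= conjCK.
rewrite /qform; under eq_bigr do rewrite -mulr_suml E.
rewrite (Ec (fun x => \sum_(y <- (o, c) :: s) k x y.1 * y.2)).
by apply: eq_bigr => x _; rewrite mulr_suml.
Qed.

Lemma psd_mobius_comp (f : C -> C) (a : C) : inner_like f -> D a ->
  psd D (fun x y => (1 - mobius a (f x) * (mobius a (f y))^*) * szego x y).
Proof.
move=> [_ fD fpsd _] aD.
apply: eq_psd (psdZ (disk_ge0 aD)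
  (psd_mulr1 (fun z => (1 - a^* * f z)^-1) fpsd)) => x y xD yD.
by rewrite mobius_kernel//; [ring|exact: fD|exact: fD].
Qed.

Lemma extend_graph (f : C -> C) (c : R) (W : set (C * C)) (z0 : C) :
  inner_like f -> 0 < c -> (forall x, W x -> D x.1) ->
  psd W (graph_kernel f c) -> D z0 ->
  exists w0, psd (W `|` [set (z0, w0)]) (graph_kernel f c).
Proof.
move=> fI c0 WD WK z0D; have [_ fD _ _] := fI.
set a := f z0; have aD : D a by exact: fD.
pose b z := mobius a (f z); pose h z := (1 - a^* * f z)^-1.
have b0 : b z0 = 0 by rewrite /b /mobius subrr mul0r.
pose Q (x y : C * C) := c%:C * szego x.1 y.1 -
  b x.1 * (x.2 * (y.2)^* * szego (f x.1) (f y.1)) * (b y.1)^*.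
have aa0 : 0 < 1 - a * a^*.
  by rewrite -normCK subr_gt0 expr_lt1 ?normr_ge0.
pose r := sqrtC (1 - a * a^*).
have r0 : 0 < r by rewrite sqrtC_gt0.
have rr : r * r = 1 - a * a^* by rewrite -expr2 sqrtCK.
have rc : r^* = r by apply/CrealP; rewrite realE (ltW r0).
pose l (x : C * C) := r * x.2 * h x.1.
(* From [s(f, f) = b b^* s(f, f) + (1 - |a|^2) h h^*]; [r] is the square root that makes the last
   term a rank one kernel. *)
have QK x y : D x.1 -> D y.1 -> Q x y - l x * (l y)^* = graph_kernel f c x y.
  move=> xD yD; rewrite /graph_kernel.
  have -> : szego (f x.1) (f y.1) = b x.1 * (b y.1)^* * szego (f x.1) (f y.1) +
      r * r * (h x.1 * (h y.1)^*).
    have := mobius_kernel_szego aD (fD _ xD) (fD _ yD).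
    by rewrite rr -/(h _) -/(b _) -/(h _) -/(b _) => <-; ring.
  by rewrite /Q /l !rmorphM /= rc; ring.
have Qpsd (w : C) : psd (W `|` [set (z0, w)]) Q.
  have WD' x : (W `|` [set (z0, w)]) x -> D x.1 by case=> [/WD|->].
  have c0' : 0 <= c%:C :> C by rewrite ler0c ltW.
  have h1 := psdZ c0' (psd_comp WD' (psd_mobius_comp fI aD)).
  have h2 : psd (W `|` [set (z0, w)])
      (fun x y => b x.1 * graph_kernel f c x y * (b y.1)^*).
    apply: (psd_mulr1_support (a := fun x => b x.1)) WK => x [//|->] /=.
    by rewrite b0 eqxx.
  apply: eq_psd (psdD h2 h1) => x y _ _.
  by rewrite /Q /graph_kernel -/(b x.1) -/(b y.1); ring.
have lW : psd W (fun x y => Q x y - l x * (l y)^*).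
  by apply: eq_psd WK => x y /WD xD /WD yD; rewrite QK.
(* The value 0 at [z0] is a placeholder, which [Q] does not see. *)
have [lam lamP] := extend_functional (Qpsd 0) lW.
have hz0 : h z0 = (r * r)^-1 by rewrite rr /h mulrC.
have r_neq0 : r != 0 by rewrite gt_eqF.
(* Since [h z0 = 1 / r^2], this is the value at which [l] takes the prescribed value [lam]. *)
exists (lam * r) => t /qform_gather[d [s [sW ->]]].
set n0 := (z0, lam * r).
have ln0 : l n0 = lam by rewrite /l /= hz0; field.
have n0D : {in (n0, d) :: s, forall x, D x.1.1}.
  by move=> x; rewrite in_cons => /orP[/eqP -> //|/sW/WD].
have -> : qform (graph_kernel f c) ((n0, d) :: s) =
    qform Q ((n0, d) :: s) - `|lform l ((n0, d) :: s)| ^+ 2.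
  rewrite /lform -qform_rank1 -mulN1r -qformZ -qformD.
  apply: (eq_qform (A := [set x | D x.1])) => // x y xD yD.
  by rewrite mulN1r QK.
have -> : qform Q ((n0, d) :: s) = qform Q (((z0, 0), d) :: s).
  have Qn y : Q n0 y = Q (z0, 0) y by rewrite /Q /= b0 !mul0r.
  have Qn' y : Q y n0 = Q y (z0, 0) by rewrite /Q /= b0 rmorph0 !mulr0.
  rewrite /qform !big_cons /= Qn Qn'.
  congr (_ + _ + _); first by apply: eq_bigr => y _; rewrite Qn.
  by apply: eq_bigr => x _; rewrite !big_cons Qn'.
rewrite subr_ge0; apply: le_trans (lamP d s sW).
by rewrite /lform big_cons /= ln0.
Qed.

(** With coefficients 1 and -1 the terms in [c] cancel and the form is
    [- s(f z, f z) |w - w'|^2]. *)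
Lemma graph_functional (f : C -> C) (c : R) (W : set (C * C)) (z w w' : C) :
  inner_like f -> D z -> psd W (graph_kernel f c) -> W (z, w) -> W (z, w') ->
  w = w'.
Proof.
move=> [_ fD _ _] zD WK Ww Ww'.
have /WK : {in [:: ((z, w), 1 : C); ((z, w'), -1)], forall x, W x.1}.
  by move=> x; rewrite !inE => /orP[] /eqP ->.
rewrite /qform !big_cons !big_nil /graph_kernel /= rmorphN rmorph1.
set S := szego (f z) (f z).
have S0 : 0 < S.
  rewrite invr_gt0 -normCK subr_gt0 expr_lt1 ?normr_ge0//.
  exact: fD.
move=> h0; have : 0 <= - (S * ((w - w') * (w - w')^*)).
  by congr (0 <= _) : h0; rewrite rmorphB /=; ring.
rewrite -normCK oppr_ge0 pmulr_rle0// => h.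
have : `|w - w'| ^+ 2 == 0 by rewrite eq_le h exprn_ge0.
by rewrite sqrf_eq0 normr_eq0 subr_eq0 => /eqP.
Qed.

Lemma psd_interpolation (S : set C) (f g : C -> C) (c : R) :
  inner_like f -> 0 < c -> S `<=` D ->
  psd S (fun x y => c%:C * szego x y - g x * (g y)^* * szego (f x) (f y)) ->
  exists2 G : C -> C, (forall z, S z -> G z = g z) &
    psd D (fun x y => c%:C * szego x y - G x * (G y)^* * szego (f x) (f y)).
Proof.
move=> fI c0 SD SK; pose Gr := [set (z, g z) | z in S].
(* Adjoining [Gr] inside [P], rather than asking [A] to contain it, lets the union of an empty chain
   satisfy [P]. *)
pose P (A : set (C * C)) :=
  (forall x, A x -> D x.1) /\ psd (A `|` Gr) (graph_kernel f c).
have GrK : psd Gr (graph_kernel f c).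
  move=> s sG; have sE : s = [seq ((x.1, g x.1), x.2) | x <- [seq (x.1.1, x.2) | x <- s]].
    rewrite -map_comp -[LHS]map_id; apply/eq_in_map => -[x d] /sG /= [z _ <-] //.
  rewrite sE /qform big_map.
  have /SK : {in [seq (x.1.1, x.2) | x <- s], forall x, S x.1}.
    by move=> _ /mapP[x /sG [z Sz e] ->] /=; rewrite -e.
  congr (0 <= _); apply: eq_bigr => x _.
  by rewrite [RHS]big_map.
have [|A [[AD AK] Amax]] := @Zorn_bigcup _ P.
  move=> F FP Ftot; split=> [x [A /FP[AD _]]|s sU]; first exact: AD.
  have [[A FA]|F0] := pselect (exists A, F A); last first.
    apply: GrK => x /sU [[A FA _]|//]; by case: F0; exists A.
  have [B FB sB] : exists2 B, F B & {in s, forall x, (B `|` Gr) x.1}.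
    elim: s sU => [|x s IHs] sU; first by exists A.
    have [|B FB sB] := IHs; first by move=> y ys; apply: sU; rewrite in_cons ys orbT.
    have [[B' FB' B'x]|xG] := sU x (mem_head _ _); last first.
      by exists B => // y; rewrite in_cons => /orP[/eqP ->|/sB //]; right.
    have [BB'|B'B] := Ftot _ _ FB FB'.
      exists B' => // y; rewrite in_cons => /orP[/eqP ->|/sB]; first by left.
      by case=> [/BB'|]; [left|right].
    exists B => // y; rewrite in_cons => /orP[/eqP ->|/sB //]; left; exact: B'B.
  exact: (FP _ FB).2 sB.
set W := A `|` Gr in AK.
have WD x : W x -> D x.1 by case=> [/AD//|[z /SD zD <-]].
have total z : D z -> exists w, W (z, w).
  move=> zD; have [w wK] := extend_graph fI c0 WD AK zD.
  exists w; apply: contrapT => nW.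
  apply: (Amax (A `|` [set (z, w)])).
    split; first by move=> x; left.
    by move=> sub; apply: nW; left; apply: sub; right.
  split=> [x [/AD//|-> //]|].
  by apply: sub_psd wK => x [[|]|]; [left; left|right|left; right].
have total' z : exists w, D z -> W (z, w).
  have [/total[w zw]|nD] := pselect (D z); first by exists w.
  by exists 0.
have [G GP] := choice total'.
exists G => [z Sz|].
  have Wg : W (z, g z) by right; exists z.
  exact: (graph_functional fI (SD _ Sz) AK (GP _ (SD _ Sz)) Wg).
exact: (psd_comp (h := fun z => (z, G z)) GP AK).
Qed.

End Interpolation.

Theorem theoremA (R : realType) (S : set (Cplx R)) (f g : Cplx R -> Cplx R)
    (S_disk : S `<=` unit_disk R)
    (f_Blaschke : is_Blaschke f)
    (S_orbit : forall z, S z -> forward_orbit f z `<=` S)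
    (g_inv : forall z, S z -> g (f z) = g z) :
  (exists G : Cplx R -> Cplx R,
     [/\ holomorphic_on_disk G, bounded_on_disk G &
         forall z, S z -> G z = g z])
  <->
  (exists M : R, 0 < M /\ psd_kernel S (period f) (Delta f g M)).
Proof.
have [fND|fI] := Blaschke_cases f_Blaschke.
  (* [S] is stable under [f] and lies in the disk, so it is empty here. *)
  have S0 z : ~ S z.
    move=> Sz; apply: (fND z (S_disk _ Sz)); apply: S_disk.
    by apply: S_orbit Sz _ _; exists 1%N.
  split=> _; last first.
    exists (fun=> 0); split=> [z _|| z /S0//]; first exact: derivable_cst.
    by exists 0 => z _; rewrite normr0.
  exists 1; split=> // m z c zS _ V _.
  by rewrite big1 // => i _; case: (S0 _ (zS i)).
have [_ fD _ [K K0 KP]] := fI.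
have D0 : unit_disk R 0 by apply/unit_diskP; rewrite normc0.
have [a a0 aE] := alpha_sqE (fD _ D0).
split.
  move=> [G [dG [B BG] Gg]].
  have GB z : unit_disk R z -> normc (G z) <= B.
    by move=> zD; rewrite -lecR; exact: BG.
  have [c c0 cK] := psd_weighted_composition fI dG GB.
  (* Chosen so that [M ^+ 2 * alpha_sq f] is [c]. *)
  exists (Num.sqrt (c / a)); split; first by rewrite sqrtr_gt0 divr_gt0.
  apply: psd_kernel_Delta => //; apply: eq_psd (sub_psd S_disk cK) => x y Sx Sy.
  rewrite /Delta00 aE !Gg//; congr (_ * _ - _).
  have -> : (Num.sqrt (c / a))%:C ^+ 2 * a%:C =
      (Num.sqrt (c / a) ^+ 2 * a)%:C :> Cplx R.
    by rewrite [RHS]rmorphM; congr (_ * _); apply/esym; exact: rmorphXn.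
  by rewrite sqr_sqrtr ?divfK ?gt_eqF// divr_ge0// ltW.
move=> [M [M0 /psd_of_psd_kernel MK]].
pose c := M ^+ 2 * a; have c0 : 0 < c by rewrite mulr_gt0// exprn_gt0.
have cE : c%:C = M%:C ^+ 2 * alpha_sq f :> Cplx R.
  by rewrite aE rmorphM rmorphXn.
have [|G Gg GK] := psd_interpolation (g := g) fI c0 S_disk.
  by rewrite cE.
exists G; split=> //.
  (* The added kernel [(G f) s(f, f) (G f)^*] equals [G (s(f, f) - 1) G^*]. *)
  have GK' : psd (unit_disk R) (fun x y => c%:C * szego x y - G x * (G y)^*).
    have fK := psd_mulr1 (fun z => G z * f z) (psd_comp fD (@psd_szego R)).
    apply: eq_psd (psdD GK fK) => x y xD yD.
    rewrite /szego rmorphM /=; field.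
    by rewrite !szegoV_neq0//; exact: fD.
  exact: (psd_derivable c0 GK').
(* The diagonal gives [|G z|^2 <= c K], and [t <= t^2 + 1] avoids a square root. *)
exists (c * K + 1) => z zD.
have sD : {in [:: (z, 1 : Cplx R)], forall x, unit_disk R x.1}.
  by move=> x; rewrite inE => /eqP ->.
have fz1 : 0 < 1 - normc (f z) ^+ 2.
  by rewrite subr_gt0 expr_lt1 ?normc_ge0//; exact/unit_diskP/fD.
have z1 : 0 < 1 - normc z ^+ 2.
  by rewrite subr_gt0 expr_lt1 ?normc_ge0//; exact/unit_diskP.
have := GK _ sD; rewrite /qform !big_cons !big_nil /= rmorph1 !mulr1 !addr0.
rewrite /szego -!defect_complex -normcCK.
have -> : c%:C * (1 - normc z ^+ 2)%:C^-1 -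
    (normc (G z) ^+ 2)%:C * (1 - normc (f z) ^+ 2)%:C^-1 =
    (c / (1 - normc z ^+ 2) - normc (G z) ^+ 2 / (1 - normc (f z) ^+ 2))%:C
    :> Cplx R.
  by rewrite [RHS]rmorphB; congr (_ - _); rewrite [RHS]rmorphM fmorphV.
rewrite ler0c subr_ge0 ler_pdivrMr// mulrAC ler_pdivlMr// => h.
have h2 : c * (1 - normc (f z) ^+ 2) <= c * (K * (1 - normc z ^+ 2)).
  by rewrite ler_pM2l// KP.
have h3 : normc (G z) ^+ 2 <= c * K.
  by rewrite -(ler_pM2r z1) -[leRHS]mulrA; exact: le_trans h h2.
rewrite -[`|G z|]/((normc (G z))%:C) lecR.
by have := sqr_ge0 (normc (G z) - 1); rewrite sqrrB1; have := normc_ge0 (G z); nra.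
Qed.
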